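(* Let $k$ be a field. Assume that $(R,\mathfrak{m}_R)$ is a noetherian complete local $k$-algebra, and let $\overline{R}=R/\underline{x}R$, where $\underline{x}\in\mathfrak{m}_R$ is a regular sequence in $R$. Then the following statements are equivalent: (i) The $\overline{R}$-module $k$ is liftable to $R$. (ii) The inclusion $k[\![\underline{x}]\!]\subseteq R$ has a retraction. (iii) There is a $k$-subalgebra $(S,\mathfrak{m}_S)$ of $(R,\mathfrak{m}_R)$ such that $R$ admits a semi-fiber product decomposition $R\cong k[\![\underline{x}]\!]\ltimes_k S$. More precisely, under these equivalent conditions, $S=k\oplus\mathfrak{m}_S$, where $\mathfrak{m}_S$ is the kernel of the retraction of the inclusion $k[\![\underline{x}]\!]\subseteq R$.
   Context: All rings are commutative with unity. A ''$k$-algebra'' $(R,\mathfrak{m}_R)$ means a (not necessarily local or noetherian) $k$-algebra $R$ with a specified maximal ideal $\mathfrak{m}_R$ such that the composition $k\hookrightarrow R\twoheadrightarrow R/\mathfrak{m}_R$ is an isomorphism; thus $R=k\oplus\mathfrak{m}_R$ as $k$-vector spaces. It is complete if it is complete in the $\mathfrak{m}_R$-adic topology. A $k$-algebra homomorphism $f\colon(R,\mathfrak{m}_R)\to(S,\mathfrak{m}_S)$ is always assumed to satisfy $f(\mathfrak{m}_R)\subseteq\mathfrak{m}_S$. $k[\![\underline{x}]\!]\subseteq R$ is the subring of power series in the elements $\underline{x}$ with coefficients in $k$, with specified maximal ideal $(\underline{x})$. Liftability: a complex $F$ of free $\overline{R}$-modules is liftable to $R$ (along the natural surjection $R\to\overline{R}$)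 if there is a complex $L$ of free $R$-modules with $L\otimes_R\overline{R}\cong F$ as $\overline{R}$-complexes. An $\overline{R}$-module $M$ is liftable to $R$ if there is an $\overline{R}$-free resolution of $M$ that is liftable to $R$. Here $k$ is the residue field of $\overline R$ as an $\overline R$-module. Retraction: if $f\colon R\to S$ and $g\colon S\to R$ are $k$-algebra homomorphisms with $f$ injective, $g$ surjective and $g\circ f=\mathrm{id}_R$, then $g$ is called a retraction of $f$. Semi-fiber product: let $(T,\mathfrak{m}_T)$ and $(S,\mathfrak{m}_S)$ be $k$-algebras with a $T$-action $\ast$ on $\mathfrak{m}_S$ under which $\mathfrak{m}_S$ becomes a $(T,S)$-bimodule (so $\ell\ast y=\ell y$ for $\ell\in k$, and $t\ast(ys)=(t\ast y)s$ for $t\in T$, $y\in\mathfrak{m}_S$, $s\in S$). The semi-fiber product $T\ltimes_k S$ is the $k$-vector space $k\oplus\mathfrak{m}_T\oplus\mathfrak{m}_S=T\oplus\mathfrak{m}_S$ with multiplication $(t\oplus y)\cdot(t'\oplus y')=tt'\oplus(t\ast y'+t'\ast y+yy')$; it is a $k$-algebra with specified maximal ideal $\mathfrak{m}_T\oplus\mathfrak{m}_S$. A $k$-algebra $(A,\mathfrak{m}_A)$ admits a semi-fiber product decomposition if there exist $k$-subalgebras $(T,\mathfrak{m}_T)$ and $(S,\mathfrak{m}_S)$ of $A$ such that an isomorphism $A\cong T\ltimes_k S$ of $k$-algebras holds.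
   Formalization: In (iii) the isomorphism is required to be the one induced by the inclusions, t ⊕ y ↦ t + y; with an arbitrary k-algebra isomorphism (iii)⇒(ii) fails, e.g. R = k[[t]], x = t², S = k. *)

(* Defs.v *)
From HB Require Import structures.
From mathcomp Require Import all_boot all_order all_algebra.
From mathcomp Require Import ring boolp mpoly.

Set Implicit Arguments.
Unset Strict Implicit.
Unset Printing Implicit Defensive.

Import GRing.Theory.
Local Open Scope ring_scope.
Local Open Scope quotient_scope.

Section Ideals.
Variable A : comNzRingType.

(* [idealr_closed] of ring_quotient describes the proper ideals; here the unit
   ideal is allowed. *)
Definition is_ideal (I : {pred A}) : Prop :=
  0 \in I /\ forall a, {in I &, forall u v, a * u + v \in I}.

Definition maximal_ideal (I : {pred A}) : Prop :=
  idealr_closed I /\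
  forall J : {pred A}, idealr_closed J -> {subset I <= J} -> {subset J <= I}.

Definition ideal_gen (n : nat) (g : 'I_n -> A) : {pred A} :=
  [pred r : A | `[< exists c : 'I_n -> A, r = \sum_i c i * g i >]].

Definition noetherian : Prop :=
  forall I : {pred A}, is_ideal I ->
    exists (n : nat) (g : 'I_n -> A), I =i ideal_gen g.

Definition ideal_pow (I : {pred A}) (N : nat) : {pred A} :=
  [pred r : A | `[< exists (p : nat) (c : 'I_p -> A) (y : 'I_p -> 'I_N -> A),
     (forall i j, y i j \in I) /\ r = \sum_i c i * \prod_j y i j >]].

(* The canonical map from A to the inverse limit of the A / I^N is bijective. *)
Definition adic_complete (I : {pred A}) : Prop :=
  (forall r, (forall N, r \in ideal_pow I N) -> r = 0) /\
  (forall u : nat -> A, (forall N, u N.+1 - u N \in ideal_pow I N) ->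
     exists r, forall N, r - u N \in ideal_pow I N).

Lemma ideal_pow_mul (I : {pred A}) N a u :
  u \in ideal_pow I N -> a * u \in ideal_pow I N.
Proof.
move=> /asboolP[p [c [y [yI ->]]]]; apply/asboolP.
exists p, (fun i => a * c i), y; split=> //.
by rewrite mulr_sumr; apply: eq_bigr => i _; rewrite mulrA.
Qed.

Lemma ideal_pow_add (I : {pred A}) N u v :
  u \in ideal_pow I N -> v \in ideal_pow I N -> u + v \in ideal_pow I N.
Proof.
move=> /asboolP[p [c [y [yI ->]]]] /asboolP[q [d [z [zI ->]]]]; apply/asboolP.
exists (p + q)%N,
  (fun i => match split i with inl j => c j | inr j => d j end),
  (fun i => match split i with inl j => y j | inr j => z j end); split.
  by move=> i j; case: (split i).
rewrite big_split_ord /=; congr (_ + _); apply: eq_bigr => i _.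
  by rewrite -[lshift _ _]/(unsplit (inl i)) unsplitK.
by rewrite -[rshift _ _]/(unsplit (inr i)) unsplitK.
Qed.

Lemma ideal_pow0 (I : {pred A}) N : 0 \in ideal_pow I N.
Proof.
apply/asboolP; exists 0%N, (fun=> 0), (fun _ _ => 0); split=> [[]//|].
by rewrite big_ord0.
Qed.

Lemma ideal_pow_opp (I : {pred A}) N u :
  u \in ideal_pow I N -> - u \in ideal_pow I N.
Proof. by rewrite -mulN1r; apply: ideal_pow_mul. Qed.

Lemma ideal_pow_sum (I : {pred A}) N (J : Type) (s : seq J) (P : pred J) F :
  (forall j, P j -> F j \in ideal_pow I N) ->
  \sum_(j <- s | P j) F j \in ideal_pow I N.
Proof.
move=> h; elim/big_rec: _ => [|j u Pj]; first exact: ideal_pow0.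
by apply: ideal_pow_add; apply: h.
Qed.

Lemma ideal_pow_prodS (I : {pred A}) N u v :
  u \in I -> v \in ideal_pow I N -> u * v \in ideal_pow I N.+1.
Proof.
move=> uI /asboolP[p [c [y [yI ->]]]]; apply/asboolP.
exists p, c, (fun i j => oapp (y i) u (unlift ord0 j)); split.
  by move=> i j; case: (unlift _ _) => /=.
rewrite mulr_sumr; apply: eq_bigr => i _.
rewrite big_ord_recl unlift_none /= mulrCA; congr (_ * (_ * _)).
by apply: eq_bigr => j _; rewrite liftK.
Qed.

Lemma ideal_powS (I : {pred A}) N u :
  u \in ideal_pow I N.+1 -> u \in ideal_pow I N.
Proof.
move=> /asboolP[p [c [y [yI ->]]]]; apply/asboolP.
exists p, (fun i => c i * y i ord0), (fun i j => y i (lift ord0 j)).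
by split=> //; apply: eq_bigr => i _; rewrite big_ord_recl mulrA.
Qed.

Lemma ideal_pow_le (I : {pred A}) M N u :
  (N <= M)%N -> u \in ideal_pow I M -> u \in ideal_pow I N.
Proof.
move=> /subnKC <-; elim: (M - N)%N => [|d IHd]; first by rewrite addn0.
by rewrite addnS => /ideal_powS.
Qed.

Lemma ideal_pow1 (I : {pred A}) u :
  idealr_closed I -> u \in ideal_pow I 1 -> u \in I.
Proof.
move=> [I0 _ IM] /asboolP[p [c [y [yI ->]]]].
elim/big_rec: _ => // i v _ vI.
by rewrite big_ord1; apply: IM.
Qed.

End Ideals.

Section Augmented.
Variable k : fieldType.

Record augAlg := AugAlg {
  aug_alg :> comAlgType k;
  aug_max : {pred aug_alg};
  aug_maxP : maximal_ideal aug_max;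
  aug_split : forall r : aug_alg, exists! c : k, r - c%:A \in aug_max
}.

Arguments aug_max : clear implicits.
Arguments aug_maxP : clear implicits.

(* A splitting A = k (+) I by a proper ideal makes I maximal. *)
Lemma split_maximal (A : comAlgType k) (I : {pred A}) :
  idealr_closed I -> (forall r : A, exists c : k, r - c%:A \in I) ->
  maximal_ideal I.
Proof.
move=> Iid sp; split=> // J [J0 J1 JM] IJ r rJ; have [c cI] := sp r.
have [c0|cN0] := eqVneq c 0; first by rewrite c0 scale0r subr0 in cI.
case/negP: J1; have cJ : c%:A \in J.
  have := JM (-1) _ _ (IJ _ cI) rJ.
  by rewrite mulN1r opprB subrK.
have := JM (c^-1)%:A _ _ cJ J0.
by rewrite addr0 -scalerAl mul1r scalerA mulVf // scale1r.
Qed.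

Lemma split_unique (A : comAlgType k) (I : {pred A}) :
  idealr_closed I -> (forall r : A, exists c : k, r - c%:A \in I) ->
  forall r : A, exists! c : k, r - c%:A \in I.
Proof.
move=> [I0 I1 IM] sp r; have [c cI] := sp r; exists c; split=> // d dI.
apply/eqP; rewrite -subr_eq0; apply/negPn/negP => cd; case/negP: I1.
have cdI : (c - d)%:A \in I.
  have := IM (-1) _ _ cI dI.
  rewrite mulN1r opprB scalerBl; congr (_ \in I).
  by rewrite addrA subrK.
have := IM ((c - d)^-1)%:A _ _ cdI I0.
by rewrite addr0 -scalerAl mul1r scalerA mulVf // scale1r.
Qed.

Definition mk_augAlg (A : comAlgType k) (I : {pred A}) (Iid : idealr_closed I)
    (sp : forall r : A, exists c : k, r - c%:A \in I) : augAlg :=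
  AugAlg (split_maximal Iid sp) (split_unique Iid sp).

Definition aug_local (A : augAlg) : Prop :=
  forall I : {pred A}, maximal_ideal I -> I =i aug_max A.

Definition aug_complete (A : augAlg) : Prop := adic_complete (aug_max A).

Section Theory.
Variable A : augAlg.
Implicit Types (r s : A) (c : k).

Lemma aug_ideal : idealr_closed (aug_max A).
Proof. by case: (aug_maxP A). Qed.

HB.instance Definition _ := isIdealr.Build A (aug_max A) aug_ideal.

Fact aug_max_scale : GRing.scaler_closed (aug_max A).
Proof.
move=> c u uA; rewrite -[u]mul1r scalerAl.
by apply: idealMr.
Qed.
HB.instance Definition _ := GRing.isScaleClosed.Build k A (aug_max A)
  aug_max_scale.

Lemma aug_max1 : (1 : A) \in aug_max A = false.
Proof. exact: idealr1. Qed.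

Fact aug_res_ex r : exists c : k, r - c%:A \in aug_max A.
Proof. by have [c [cA _]] := aug_split r; exists c. Qed.

Definition aug_res r : k := xchoose (aug_res_ex r).

Lemma aug_resP r : r - (aug_res r)%:A \in aug_max A.
Proof. exact: (xchooseP (aug_res_ex r)). Qed.

Lemma aug_res_uniq r c : r - c%:A \in aug_max A -> aug_res r = c.
Proof.
move=> rc; have [d [_ dU]] := aug_split r.
by rewrite -(dU c rc) -(dU _ (aug_resP r)).
Qed.

Fact aug_res_zmod : zmod_morphism aug_res.
Proof.
move=> r s; apply: aug_res_uniq.
rewrite scalerBl.
have -> : r - s - ((aug_res r)%:A - (aug_res s)%:A) =
   (r - (aug_res r)%:A) - (s - (aug_res s)%:A) by ring.
by rewrite rpredB ?aug_resP.
Qed.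

Fact aug_res_monoid : monoid_morphism aug_res.
Proof.
split=> [|r s]; apply: aug_res_uniq; first by rewrite scale1r subrr rpred0.
have -> : r * s - (aug_res r * aug_res s)%:A =
    r * (s - (aug_res s)%:A) + (aug_res s)%:A * (r - (aug_res r)%:A).
  rewrite !mulrBr addrA [r * (_)%:A]mulrC subrK.
  by rewrite -scalerAl mul1r scalerA [aug_res s * _]mulrC.
by rewrite rpredD // idealMr // aug_resP.
Qed.

End Theory.

HB.instance Definition _ (A : augAlg) := GRing.isZmodMorphism.Build A k
  (@aug_res A) (@aug_res_zmod A).
HB.instance Definition _ (A : augAlg) := GRing.isMonoidMorphism.Build A k
  (@aug_res A) (@aug_res_monoid A).

Lemma aug_res0 (A : augAlg) (r : A) : r \in aug_max A -> aug_res r = 0.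
Proof. by move=> rA; apply: aug_res_uniq; rewrite scale0r subr0. Qed.

End Augmented.
Arguments aug_max {k} _ _.
Arguments aug_maxP {k} _.

Section MaxIdeal.
Variables (k : fieldType) (A : augAlg k).

Definition maxid : Type := {r : A | r \in aug_max A}.
HB.instance Definition _ := SubType.on maxid.
HB.instance Definition _ := Choice.on maxid.
HB.instance Definition _ := [SubChoice_isSubLmodule of maxid by <:].

Fact maxid_mul_subproof (y : maxid) (s : A) : val y * s \in aug_max A.
Proof. by rewrite mulrC idealMr // (valP y). Qed.
Definition maxid_mul (y : maxid) (s : A) : maxid :=
  exist _ (val y * s) (maxid_mul_subproof y s).

End MaxIdeal.

Definition aug_hom (k : fieldType) (A B : augAlg k) (f : {lrmorphism A -> B}) :
    Prop :=
  forall r, r \in aug_max A -> f r \in aug_max B.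

Definition aug_iso (k : fieldType) (A B : augAlg k) (f : {lrmorphism A -> B}) :
    Prop :=
  bijective f /\ forall r, (f r \in aug_max B) = (r \in aug_max A).

(* g is a retraction of f. *)
Definition is_retraction (k : fieldType) (A B : augAlg k)
    (f : {lrmorphism A -> B}) (g : {lrmorphism B -> A}) : Prop :=
  [/\ aug_hom f, aug_hom g, injective f, (forall a, exists b, g b = a)
    & cancel f g].

Section Subalgebras.
Variables (k : fieldType) (A : augAlg k) (S : subalgClosed A).

Definition sub_type : Type := {r : A | r \in S}.
HB.instance Definition _ := SubType.on sub_type.
HB.instance Definition _ := Choice.on sub_type.
HB.instance Definition _ := [SubChoice_isSubAlgebra of sub_type by <:].
HB.instance Definition _ := [SubNzRing_isSubComNzRing of sub_type by <:].

Definition sub_incl (r : sub_type) : A := val r.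
Fact sub_incl_zmod : zmod_morphism sub_incl.
Proof. by move=> r s; rewrite /sub_incl rmorphB. Qed.
Fact sub_incl_monoid : monoid_morphism sub_incl.
Proof. by split=> [|r s]; rewrite /sub_incl ?rmorph1 ?rmorphM. Qed.
Fact sub_incl_scale : scalable sub_incl.
Proof. by move=> c r; rewrite /sub_incl linearZ. Qed.
HB.instance Definition _ := GRing.isZmodMorphism.Build sub_type A sub_incl
  sub_incl_zmod.
HB.instance Definition _ := GRing.isMonoidMorphism.Build sub_type A sub_incl
  sub_incl_monoid.
HB.instance Definition _ := GRing.isScalable.Build k sub_type A *:%R sub_incl
  sub_incl_scale.

Definition sub_max : {pred sub_type} := [pred r | sub_incl r \in aug_max A].

Lemma in_sub_max r : (r \in sub_max) = (sub_incl r \in aug_max A).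
Proof. by []. Qed.

Fact sub_max_ideal : idealr_closed sub_max.
Proof.
split; rewrite ?in_sub_max; first by rewrite rmorph0 rpred0.
  by rewrite rmorph1 aug_max1.
move=> a u v; rewrite !in_sub_max => uS vS.
by rewrite rmorphD rmorphM rpredD // idealMr.
Qed.

Fact sub_max_split (r : sub_type) : exists c : k, r - c%:A \in sub_max.
Proof.
exists (aug_res (sub_incl r)); rewrite in_sub_max.
by rewrite rmorphB /= sub_incl_scale rmorph1 aug_resP.
Qed.

(* The inclusion into A must map m_S into m_A, and S = k (+) m_S; hence
   m_S is the intersection of S and m_A (see [sub_max_uniq]). *)
Definition sub_aug : augAlg k := mk_augAlg sub_max_ideal sub_max_split.

Lemma sub_max_uniq (I : {pred sub_type}) : maximal_ideal I ->
  {subset I <= sub_max} -> I =i sub_max.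
Proof.
by move=> [_ h] Isub r; apply/idP/idP => [/Isub//|]; apply: h => //;
   apply: sub_max_ideal.
Qed.

End Subalgebras.

Section PowerSeries.
Variables (k : fieldType) (A : augAlg k) (n : nat) (x : 'I_n -> maxid A).
Implicit Types (a b : 'X_{1..n} -> k).

Local Notation xv := (fun i => val (x i)).
Local Notation mon := (mmap1 (fun i => val (x i))).

Definition psum a N : A := \sum_(m : 'X_{1..n < N}) a m *: mon m.

(* The underlying set of k[[x]]: sums of power series in the x i, convergent in
   the m_A-adic topology. *)
Definition pser : {pred A} := [pred r : A |
  `[< exists a, forall N, r - psum a N \in ideal_pow (aug_max A) N >]].

Definition ptrunc a N : {mpoly k[n]} := \sum_(m : 'X_{1..n < N}) a m *: 'X_[m].
Definition peval : {mpoly k[n]} -> A := mmap (in_alg A) xv.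
HB.instance Definition _ := GRing.RMorphism.on peval.

Lemma peval_sum (I : Type) (s : seq I) (P : pred I) (F : I -> k) (g : I -> 'X_{1..n}) :
  peval (\sum_(i <- s | P i) F i *: 'X_[g i]) = \sum_(i <- s | P i) F i *: mon (g i).
Proof.
rewrite raddf_sum; apply: eq_bigr => i _ /=.
by rewrite /peval mmapZ mmapX /= -scalerAl mul1r.
Qed.

Lemma peval_trunc a N : peval (ptrunc a N) = psum a N.
Proof. exact: peval_sum. Qed.

Lemma mon_pow (m : 'X_{1..n}) : mon m \in ideal_pow (aug_max A) (mdeg m).
Proof.
have := mdegE m; rewrite /mmap1; move: (mdeg m) => d ->.
elim/big_rec2: _ => [|i e u _ IH].
  apply/asboolP; exists 1%N, (fun=> 1), (fun _ _ => 0).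
  by split=> [? []//|]; rewrite big_ord1 big_ord0 mulr1.
elim: (m i) => [|j IHj]; first by rewrite expr0 mul1r.
by rewrite exprS -mulrA addSn; apply: ideal_pow_prodS => //; apply: (valP (x i)).
Qed.

Lemma peval_pow N (p : {mpoly k[n]}) :
  (forall m, (mdeg m < N)%N -> p@_m = 0) -> peval p \in ideal_pow (aug_max A) N.
Proof.
move=> p0; rewrite /peval /mmap; apply: ideal_pow_sum => m _.
have [/p0 ->|Nm] := ltnP (mdeg m) N.
  by rewrite rmorph0 mul0r ideal_pow0.
by apply: ideal_pow_mul; apply: ideal_pow_le (mon_pow m).
Qed.

Lemma peval_congr N (p q : {mpoly k[n]}) :
  (forall m, (mdeg m < N)%N -> p@_m = q@_m) ->
  peval p - peval q \in ideal_pow (aug_max A) N.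
Proof.
move=> pq; rewrite -rmorphB; apply: peval_pow => m mN.
by rewrite mcoeffB pq // subrr.
Qed.

Lemma mcoeff_trunc a N m : (mdeg m < N)%N -> (ptrunc a N)@_m = a m.
Proof. exact: mcoeff_mpoly. Qed.

Fact pser_closed : GRing.subalg_closed pser.
Proof.
split.
- apply/asboolP; exists (fun m => (m == 0%MM)%:R) => N.
  rewrite -peval_trunc -(rmorph1 peval); apply: peval_congr => m mN.
  by rewrite mcoeff_trunc // -mpolyX0 mcoeffX eq_sym.
- move=> c r s /asboolP[a ra] /asboolP[b sb]; apply/asboolP.
  exists (fun m => c * a m + b m) => N.
  have -> : psum (fun m => c * a m + b m) N = c *: psum a N + psum b N.
    rewrite /psum scaler_sumr -big_split /=; apply: eq_bigr => m _.
    by rewrite scalerDl scalerA.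
  rewrite opprD addrACA -scalerBr ideal_pow_add //.
  by rewrite -[_ - _]mul1r scalerAl ideal_pow_mul.
move=> r s /asboolP[a ra] /asboolP[b sb]; apply/asboolP.
exists (fun m => \sum_(h : 'X_{1..n < (mdeg m).+1, (mdeg m).+1} |
                        m == (h.1 + h.2)%MM) a h.1 * b h.2) => N.
set c := (fun m => _).
have -> : r * s - psum c N = s * (r - psum a N) + psum a N * (s - psum b N)
   + (psum a N * psum b N - psum c N) by ring.
apply: ideal_pow_add.
  by rewrite ideal_pow_add // ideal_pow_mul.
rewrite -!peval_trunc -(rmorphM peval); apply: peval_congr => m mN.
rewrite mcoeff_trunc // mcoeffM; apply: eq_bigr => h /eqP mh.
by rewrite !mcoeff_trunc // (leq_trans (bmdeg _)).
Qed.

HB.instance Definition _ := GRing.isSubalgClosed.Build k A pser pser_closed.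

Definition pser_alg : augAlg k := sub_aug pser.

Fact pser_var_subproof i : val (x i) \in pser.
Proof.
apply/asboolP; exists (fun m => (m == U_(i)%MM)%:R) => N.
have -> : val (x i) = peval 'X_i by rewrite /peval mmapX mmap1U.
rewrite -peval_trunc; apply: peval_congr => m mN.
by rewrite mcoeff_trunc // mcoeffX eq_sym.
Qed.
Definition pser_var i : pser_alg := exist _ (val (x i)) (pser_var_subproof i).

Lemma mcoeffMXi (p : {mpoly k[n]}) i (m : 'X_{1..n}) :
  (p * 'X_i)@_m = if (0 < m i)%N then p@_(m - U_(i))%MM else 0.
Proof.
case: ifPn => [mi|].
  have le : (U_(i) <= m)%MM.
    by apply/mnm_lepP => j; rewrite mnm1E; case: eqP => // <-.
  by rewrite -{1}(submK le) addmC mcoeffMX.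
rewrite -eqn0Ngt => /eqP mi; rewrite mcoeffM big1 // => h /eqP mh.
rewrite mcoeffX; case: eqP => [e|]; last by rewrite mulr0.
have := congr1 (fun m : 'X_{1..n} => m i) mh.
by rewrite mnmDE -e mnm1E eqxx mi addn1.
Qed.

(* The specified maximal ideal of k[[x]] is the one generated by x. *)
Lemma pser_max : aug_complete A -> aug_max pser_alg =i ideal_gen pser_var.
Proof.
move=> [sep cpl] r; apply/idP/asboolP => [rm | [c ->]]; last first.
  rewrite in_sub_max rmorph_sum rpred_sum // => i _ /=.
  by rewrite rmorphM /= idealMr //; apply: (valP (x i)).
have [a ra] := asboolW (valP r).
have a0 : a 0%MM = 0.
  have h1 : val r - (a 0%MM)%:A \in aug_max A.
    apply: ideal_pow1 (aug_ideal A) _.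
    have -> : (a 0%MM)%:A = peval (a 0%MM)%:MP.
      by rewrite /peval mmapC.
    rewrite -[val r](subrK (psum a 1)) -addrA ideal_pow_add // -peval_trunc.
    apply: peval_congr => m; rewrite ltnS leqn0 mdeg_eq0 => /eqP ->.
    by rewrite mcoeff_trunc ?mdeg0 // mcoeffC eqxx mulr1.
  by rewrite -(aug_res_uniq h1) aug_res0.
pose c (i : 'I_n) (m : 'X_{1..n}) := if [forall j : 'I_n, (j < i)%N ==> (m j == 0%N)]
                   then a (m + U_(i))%MM else 0.
have cN N (m : 'X_{1..n}) : (mdeg m < N.+1)%N ->
    (\sum_i ptrunc (c i) N * 'X_i)@_m = (ptrunc a N.+1)@_m.
  move=> mN; rewrite mcoeff_trunc // raddf_sum /=.
  have [->|m0] := eqVneq m 0%MM.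
    by rewrite big1 // => i _; rewrite mcoeffMXi mnm0E.
  have [i mi0] : exists i, (0 < m i)%N.
    apply/existsP; apply: contraNT m0; rewrite negb_exists => /forallP h.
    by apply/eqP/mnmP => i; rewrite mnm0E; have := h i; rewrite -eqn0Ngt => /eqP.
  case: (@arg_minnP _ i (fun i => 0 < m i)%N (fun i => i : nat) mi0) => i0 mi i0min {i mi0}.
  rewrite (bigD1 i0) //= big1 ?addr0 => [|i ii0].
    have le : (U_(i0) <= m)%MM.
      by apply/mnm_lepP => j; rewrite mnm1E; case: eqP => // <-.
    have dm : (mdeg (m - U_(i0))%MM < N)%N.
      by rewrite -ltnS; move: mN; rewrite -{1}(submK le) mdegD mdeg1 addn1.
    rewrite mcoeffMXi mi mcoeff_trunc // /c submK //.
    case: ifPn => // /forallPn[j]; rewrite negb_imply => /andP[ji].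
    rewrite mnmBE subn_eq0 -ltnNge => mj.
    by have := i0min j (leq_ltn_trans (leq0n _) mj); rewrite leqNgt ji.
  rewrite mcoeffMXi; case: ifPn => // mi'.
  have i0i : (i0 < i)%N.
    by rewrite ltn_neqAle i0min // andbT eq_sym.
  have le : (U_(i) <= m)%MM.
    by apply/mnm_lepP => j; rewrite mnm1E; case: eqP => // <-.
  have dm : (mdeg (m - U_(i))%MM < N)%N.
    by rewrite -ltnS; move: mN; rewrite -{1}(submK le) mdegD mdeg1 addn1.
  rewrite mcoeff_trunc // /c; case: ifPn => // /forallP/(_ i0).
  rewrite i0i /= mnmBE mnm1E; case: (i =P i0) => [e|_]; last first.
    by rewrite subn0 => /eqP e; rewrite e in mi.
  by rewrite e ltnn in i0i.
have lim (i : 'I_n) : exists ri, forall N, ri - psum (c i) N \in ideal_pow (aug_max A) N.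
  apply: cpl => N; rewrite -!peval_trunc; apply: peval_congr => m mN.
  by rewrite !mcoeff_trunc // ltnW.
have [f fP] := choice lim.
have fpser i : f i \in pser by apply/asboolP; exists (c i).
pose g i : pser_alg := exist _ (f i) (fpser i).
exists g; apply: val_inj; apply/eqP; rewrite -subr_eq0; apply/eqP/sep => N.
have -> : val r - val (\sum_i g i * pser_var i) =
   (val r - psum a N.+1)
   + (psum a N.+1 - peval (\sum_i ptrunc (c i) N * 'X_i))
   - \sum_i (f i - psum (c i) N) * val (x i).
  have -> : peval (\sum_i ptrunc (c i) N * 'X_i) =
      \sum_i psum (c i) N * val (x i).
    rewrite rmorph_sum; apply: eq_bigr => i _.
    by rewrite rmorphM /= peval_trunc /peval mmapX mmap1U.
  have -> : \sum_i (f i - psum (c i) N) * val (x i) =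
      \sum_i f i * val (x i) - \sum_i psum (c i) N * val (x i).
    by rewrite -sumrB; apply: eq_bigr => i _; rewrite mulrBl.
  have -> : val (\sum_i g i * pser_var i) = \sum_i f i * val (x i).
    rewrite -[LHS]/(sub_incl _) rmorph_sum; apply: eq_bigr => i _.
    by rewrite rmorphM.
  by ring.
apply: ideal_pow_add; last first.
  apply: ideal_pow_opp; apply: ideal_pow_sum => i _.
  by rewrite mulrC ideal_pow_mul.
apply: ideal_pow_add; apply: ideal_powS => //.
rewrite -peval_trunc; apply: peval_congr => m mN.
by rewrite cN.
Qed.

End PowerSeries.

(* m_S as a (T, S)-bimodule extending its structure of ideal of S. *)
Record sf_action (k : fieldType) (T S : augAlg k) := SfAction {
  act :> T -> maxid S -> maxid S;
  actDl : forall t t' y, act (t + t') y = act t y + act t' y;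
  actDr : forall t y y', act t (y + y') = act t y + act t y';
  actM : forall t t' y, act (t * t') y = act t (act t' y);
  act_scalar : forall (c : k) y, act c%:A y = c *: y;
  act_mulr : forall t y (s : S), act t (maxid_mul y s) = maxid_mul (act t y) s
}.

Definition sf_type (k : fieldType) (T S : augAlg k) (a : sf_action T S) : Type :=
  (T * maxid S)%type.

Section SemiFiber.
Variables (k : fieldType) (T S : augAlg k) (a : sf_action T S).
Local Notation sf_type := (sf_type a).

HB.instance Definition _ := GRing.Lmodule.copy sf_type (T * maxid S)%type.

Definition sf_one : sf_type := (1, 0).
Definition sf_mul (u v : sf_type) : sf_type :=
  (u.1 * v.1, a u.1 v.2 + a v.1 u.2 + maxid_mul u.2 (val v.2)).

Fact val_maxid_mul (y : maxid S) s : val (maxid_mul y s) = val y * s.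
Proof. by []. Qed.

Fact val_maxidD (y z : maxid S) : val (y + z) = val y + val z.
Proof. by []. Qed.

Fact val_maxidZ (c : k) (y : maxid S) : val (c *: y) = c *: val y.
Proof. by []. Qed.

Fact act1 y : a 1 y = y.
Proof. by rewrite -[1]scale1r act_scalar scale1r. Qed.

Fact act0 t : a t 0 = 0.
Proof. by apply: (addrI (a t 0)); rewrite -actDr !addr0. Qed.

Fact actC t t' y : a t (a t' y) = a t' (a t y).
Proof. by rewrite -!actM mulrC. Qed.

Fact act_mull t y y' : val y * val (a t y') = val (a t y) * val y'.
Proof.
rewrite -[RHS]val_maxid_mul -act_mulr mulrC -val_maxid_mul -act_mulr.
by congr (val (a t _)); apply: val_inj; rewrite /= mulrC.
Qed.

Fact sf_mulC : commutative sf_mul.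
Proof.
move=> u v; congr (_, _); first exact: mulrC.
rewrite [a u.1 _ + _]addrC; congr (_ + _).
by apply: val_inj; rewrite /= mulrC.
Qed.

Fact sf_mulA : associative sf_mul.
Proof.
move=> [t y] [t' y'] [t'' y'']; congr (_, _); rewrite /sf_mul ?mulrA //.
rewrite /fst /snd; apply: val_inj.
rewrite !(actDr, actM, act_mulr) !(val_maxidD, val_maxid_mul).
rewrite !mulrDr !act_mull (actC t'' t) (actC t'' t').
by ring.
Qed.

Fact sf_mul1 : left_id sf_one sf_mul.
Proof.
move=> [t y]; congr (_, _); first exact: mul1r.
rewrite /fst /snd act1 act0 addr0; apply: val_inj.
by rewrite val_maxidD val_maxid_mul mul0r addr0.
Qed.

Fact sf_mulDl : left_distributive sf_mul +%R.
Proof.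
move=> [t y] [t' y'] [t'' y'']; congr (_, _); first exact: mulrDl.
rewrite /fst /snd; apply: val_inj.
rewrite actDl actDr !(val_maxidD, val_maxid_mul).
by ring.
Qed.

Fact sf_one_neq0 : sf_one != 0.
Proof. by apply/eqP => -[/eqP]; rewrite oner_eq0. Qed.

HB.instance Definition _ := GRing.Zmodule_isComNzRing.Build sf_type
  sf_mulA sf_mulC sf_mul1 sf_mulDl sf_one_neq0.

Fact sf_scaleAl (c : k) (u v : sf_type) : c *: (u * v) = (c *: u) * v.
Proof.
case: u v => [t y] [t' y']; congr (_, _); first exact: scalerAl.
rewrite /fst /snd.
have -> : a (c *: t) y' = c *: a t y'.
  by rewrite -[t in c *: t]mul1r scalerAl actM act_scalar.
have -> : a t' (c *: y) = c *: a t' y by rewrite -!(act_scalar a) actC.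
rewrite !scalerDr; congr (_ + _); apply: val_inj.
by rewrite val_maxidZ !val_maxid_mul val_maxidZ scalerAl.
Qed.

HB.instance Definition _ := GRing.Lmodule_isLalgebra.Build k sf_type sf_scaleAl.
HB.instance Definition _ := GRing.Lalgebra_isComAlgebra.Build k sf_type.

Definition sf_max : {pred sf_type} := [pred u | u.1 \in aug_max T].

Fact sf_max_ideal : idealr_closed sf_max.
Proof.
split; rewrite ?inE /=; first exact: rpred0.
  by rewrite aug_max1.
move=> u v w vT wT; rewrite inE /=.
by apply: rpredD => //; apply: idealMr.
Qed.

Fact sf_max_split (u : sf_type) : exists c : k, u - c%:A \in sf_max.
Proof. by exists (aug_res u.1); rewrite inE /= aug_resP. Qed.

(* The semi-fiber product of T and S over k, on the vector space T (+) m_S. *)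
Definition sf_prod : augAlg k := mk_augAlg sf_max_ideal sf_max_split.

End SemiFiber.

(* The isomorphism is the one induced by the inclusions of T and m_S in A. *)
Definition sf_decomposition (k : fieldType) (A : augAlg k)
    (T S : subalgClosed A) : Prop :=
  exists (a : sf_action (sub_aug T) (sub_aug S))
         (phi : {lrmorphism sf_prod a -> A}),
    aug_iso phi /\
    forall (t : sub_aug T) (y : maxid (sub_aug S)),
      phi (t, y) = sub_incl t + sub_incl (val y).

Section RegularSequences.
Variables (A : comNzRingType) (n : nat) (x : 'I_n -> A).

(* The ideal (x_0, ..., x_{i-1}). *)
Definition ideal_init (i : nat) : {pred A} :=
  [pred r : A |
    `[< exists c : 'I_n -> A, r = \sum_(j < n | (j < i)%N) c j * x j >]].

(* x_i is a nonzerodivisor on A / (x_0, ..., x_{i-1}), and A / (x) is nonzero. *)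
Definition regular_seq : Prop :=
  (forall (i : 'I_n) (r : A), x i * r \in ideal_init i -> r \in ideal_init i) /\
  1 \notin ideal_gen x.

End RegularSequences.

(* k as a module over A / (x), through the residue map A / (x) -> k. *)
Definition res_mod (k : fieldType) (A : augAlg k) (n : nat)
  (x : 'I_n -> maxid A) : Type := k.

Section Quotients.
Variables (k : fieldType) (A : augAlg k) (n : nat) (x : 'I_n -> maxid A).

Definition seq_ideal : {pred A} := ideal_gen (fun i => val (x i)).

Lemma seq_ideal_max r : r \in seq_ideal -> r \in aug_max A.
Proof.
move=> /asboolP[c ->]; apply: rpred_sum => i _.
by apply: idealMr; apply: (valP (x i)).
Qed.

Fact seq_ideal_closed : idealr_closed seq_ideal.
Proof.
split.
- by apply/asboolP; exists (fun=> 0); rewrite big1 // => i _; rewrite mul0r.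
- by apply/negP => /seq_ideal_max; rewrite aug_max1.
move=> a u v /asboolP[c ->] /asboolP[d ->]; apply/asboolP.
exists (fun i => a * c i + d i); rewrite mulr_sumr -big_split /=.
by apply: eq_bigr => i _; rewrite mulrDl mulrA.
Qed.
HB.instance Definition _ := isIdealr.Build A seq_ideal seq_ideal_closed.

Definition seq_quot : Type := {ideal_quot seq_ideal}.
HB.instance Definition _ := GRing.ComNzRing.on seq_quot.

Definition seq_proj (r : A) : seq_quot := \pi_seq_quot r.
Fact seq_proj_zmod : zmod_morphism seq_proj.
Proof. exact: pi_is_zmod_morphism. Qed.
Fact seq_proj_monoid : monoid_morphism seq_proj.
Proof. exact: pi_is_monoid_morphism. Qed.
HB.instance Definition _ := GRing.isZmodMorphism.Build A seq_quot seq_proj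
  seq_proj_zmod.
HB.instance Definition _ := GRing.isMonoidMorphism.Build A seq_quot seq_proj
  seq_proj_monoid.

Definition quot_res (q : seq_quot) : k := aug_res (repr q).

Lemma quot_res_proj r : quot_res (seq_proj r) = aug_res r.
Proof.
apply/eqP; rewrite -subr_eq0 -rmorphB; apply/eqP/aug_res0/seq_ideal_max.
by rewrite Quotient.idealrBE reprK.
Qed.

Lemma seq_proj_surj (q : seq_quot) : exists r, q = seq_proj r.
Proof. by exists (repr q); rewrite /seq_proj reprK. Qed.

Fact quot_res_zmod : zmod_morphism quot_res.
Proof.
move=> p q; have [[r ->] [s ->]] := (seq_proj_surj p, seq_proj_surj q).
by rewrite -rmorphB !quot_res_proj rmorphB.
Qed.
Fact quot_res_monoid : monoid_morphism quot_res.
Proof.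
split=> [|p q]; first by rewrite -(rmorph1 seq_proj) quot_res_proj rmorph1.
have [[r ->] [s ->]] := (seq_proj_surj p, seq_proj_surj q).
by rewrite -rmorphM !quot_res_proj rmorphM.
Qed.
HB.instance Definition _ := GRing.isZmodMorphism.Build seq_quot k quot_res
  quot_res_zmod.
HB.instance Definition _ := GRing.isMonoidMorphism.Build seq_quot k quot_res
  quot_res_monoid.

Local Notation res_mod := (res_mod x).
HB.instance Definition _ := GRing.Zmodule.copy res_mod k.
Definition res_scale (q : seq_quot) (v : res_mod) : res_mod :=
  quot_res q * v :> k.
Fact res_scaleA p q v : res_scale p (res_scale q v) = res_scale (p * q) v.
Proof. by rewrite /res_scale mulrA -rmorphM. Qed.
Fact res_scale1 : left_id 1 res_scale.
Proof. by move=> v; rewrite /res_scale rmorph1 mul1r. Qed.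
Fact res_scaleDr : right_distributive res_scale +%R.
Proof. by move=> q u v; apply: mulrDr. Qed.
Fact res_scaleDl v : {morph res_scale^~ v : p q / p + q}.
Proof. by move=> p q; rewrite /res_scale rmorphD mulrDl. Qed.
HB.instance Definition _ := GRing.Zmodule_isLmodule.Build seq_quot res_mod
  res_scaleA res_scale1 res_scaleDr res_scaleDl.

End Quotients.

Definition is_free (R : nzRingType) (M : lmodType R) : Prop :=
  exists B : M -> Prop,
    (forall v : M, exists (s : seq M) (c : M -> R),
       (forall b, b \in s -> B b) /\ v = \sum_(b <- s) c b *: b) /\
    (forall (s : seq M) (c : M -> R), uniq s -> (forall b, b \in s -> B b) ->
       \sum_(b <- s) c b *: b = 0 -> forall b, b \in s -> c b = 0).

(* The index of the source is written 1 + i, rather than i + 1, because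
   1 + n%:Z is convertible to n.+1%:Z. *)
Record complex (R : nzRingType) := Complex {
  cx_mod :> int -> lmodType R;
  cx_d : forall i : int, {linear cx_mod (1 + i) -> cx_mod i};
  cx_dd : forall i v, cx_d i (cx_d (1 + i) v) = 0
}.

Definition free_complex (R : nzRingType) (C : complex R) : Prop :=
  forall i, is_free (C i).

Definition resolution (R : nzRingType) (C : complex R) (M : lmodType R) : Prop :=
  [/\ forall (n : nat) (v : C (Negz n)), v = 0,
      forall (n : nat) (v : C (1 + n%:Z)),
        cx_d C n%:Z v = 0 -> exists w, v = cx_d C (1 + n%:Z) w
    & exists aug : {linear C 0 -> M},
        (forall u, exists v, aug v = u) /\
        (forall v, aug v = 0 <-> exists w, v = cx_d C 0 w)].

Section Liftings.
Variables (R Rbar : comNzRingType) (pi : {rmorphism R -> Rbar}).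

(* phi exhibits N as the tensor product M (x)_R Rbar, by its universal property
   among the Rbar-modules: phi v stands for v (x) 1. *)
Definition base_change (M : lmodType R) (N : lmodType Rbar)
    (phi : {linear M -> N | pi \; *:%R}) : Prop :=
  forall (P : lmodType Rbar) (h : {linear M -> P | pi \; *:%R}),
    exists g : {linear N -> P},
      (forall v, g (phi v) = h v) /\
      (forall g' : {linear N -> P}, (forall v, g' (phi v) = h v) -> g' =1 g).

Definition liftable_complex (F : complex Rbar) : Prop :=
  exists L : complex R, free_complex L /\
    exists phi : forall i, {linear L i -> F i | pi \; *:%R},
      (forall i, base_change (phi i)) /\
      (forall i v, phi i (cx_d L i v) = cx_d F i (phi (1 + i) v)).

Definition liftable (M : lmodType Rbar) : Prop :=
  exists F : complex Rbar,
    [/\ free_complex F, resolution F M & liftable_complex F].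

End Liftings.

Section Retractions.
Variables (k : fieldType) (A : augAlg k) (n : nat) (x : 'I_n -> maxid A).

Definition pser_incl : {lrmorphism pser_alg x -> A} := @sub_incl k A (pser x).

(* S = k (+) m_S, with m_S the kernel of g. *)
Definition split_by_kernel (g : {lrmorphism A -> pser_alg x})
    (S : subalgClosed A) : Prop :=
  (forall r : A, r \in S <-> exists (c : k) (y : A), g y = 0 /\ r = c%:A + y) /\
  (forall r : A, g r = 0 <->
     exists2 s : sub_aug S, s \in aug_max (sub_aug S) & r = sub_incl s).

End Retractions.

(* Main.v *)
Require Import Defs.
From HB Require Import structures.
From mathcomp Require Import all_boot all_order all_algebra.
From mathcomp Require Import ring boolp mpoly.

Set Implicit Arguments.
Unset Strict Implicit.
Unset Printing Implicit Defensive.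

Import GRing.Theory.
Local Open Scope ring_scope.

(** Write I for the ideal of R generated by the regular sequence x, and m for
   the maximal ideal of R.

   From a lifting to a retraction.  Let L be a complex of free R-modules whose
   reduction modulo I resolves k, and let N = L_0 / d(L_1).  Then N / IN = k,
   and x stays quasi-regular on N: the associated graded module of N for the
   powers of I is k[X_1, ..., X_n].  Indeed x is quasi-regular on R
   ([regular_quasi_regular]), hence on the free module L_0
   ([free_quasi_regular]); if d u lies in I^d L_0, exactness of L / IL at L_1
   lets one correct u by boundaries until u lies in I^d L_1 ([lift_boundary]),
   so that no relation between the monomials in x is created in N
   ([filt_hsum_inv]).  Let e in L_0 lift 1 in k.  As m N = IN, every r e has,
   modulo each I^D N, a unique expansion a(x) e with a polynomial a over k of
   degree less than D ([psum_ex], [psum_uniq]).  By completeness these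
   polynomials converge to a power series f in x, and r - f lies in the ideal J
   of all s such that s e is in d(L_1) + I^D L_0 for every D.  Thus R is the
   direct sum of k[[x]] and J, and the projection with kernel J is the
   retraction.  The modules L_i may have infinite rank: only congruences modulo
   powers of I are solved in them, never equations in a limit.

   From a retraction to a lifting.  Let J be the kernel of the retraction g.
   Applying g to a relation shows that x is regular on R / J = k[[x]].  Since R
   is noetherian, R / J has a resolution L by free modules of finite rank
   ([noetherian_resolution]).  As x is regular on R / J and on each L_i, the
   complex L / IL is exact in positive degrees ([exact_modulo]), and its
   homology in degree 0 is R / (I + J) = k because the maximal ideal of k[[x]]
   is generated by x.  So L lifts a free resolution of k.

   Retractions and decompositions.  The kernel J of a retraction is the maximal
   ideal of the subalgebra S = k + J, on which k[[x]] acts by multiplication,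
   and R = k[[x]] + J is then the semi-fiber product; conversely the first
   projection of a semi-fiber product is a retraction. *)

(** * Regular sequences are quasi-regular *)

Lemma mem_ideal_gen (A : comNzRingType) n (g : 'I_n -> A) i :
  g i \in ideal_gen g.
Proof.
apply/asboolP; exists (fun j => (j == i)%:R).
rewrite (bigD1 i) //= eqxx mul1r big1 ?addr0 // => j /negPf ->.
by rewrite mul0r.
Qed.

Section QuasiRegular.
Variables (A : comNzRingType) (n : nat) (x : 'I_n -> A).
Implicit Types (F G H : {mpoly A[n]}) (m : 'X_{1..n}).

Lemma ideal_init0 i : 0 \in ideal_init x i.
Proof.
by apply/asboolP; exists (fun=> 0); rewrite big1 // => j _; rewrite mul0r.
Qed.

Lemma ideal_initMD i a u v :
  u \in ideal_init x i -> v \in ideal_init x i -> a * u + v \in ideal_init x i.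
Proof.
move=> /asboolP[c ->] /asboolP[d ->]; apply/asboolP.
exists (fun j => a * c j + d j); rewrite mulr_sumr -big_split /=.
by apply: eq_bigr => j _; rewrite mulrDl mulrA.
Qed.

Lemma ideal_initM i a u : u \in ideal_init x i -> a * u \in ideal_init x i.
Proof.
by move=> uI; rewrite -[a * u]addr0; apply: ideal_initMD; rewrite ?ideal_init0.
Qed.

Lemma ideal_initD i u v :
  u \in ideal_init x i -> v \in ideal_init x i -> u + v \in ideal_init x i.
Proof. by rewrite -{2}[u]mul1r; apply: ideal_initMD. Qed.

Lemma ideal_initB i u v :
  u \in ideal_init x i -> v \in ideal_init x i -> u - v \in ideal_init x i.
Proof. by move=> uI vI; rewrite addrC -mulN1r; apply: ideal_initMD. Qed.

Lemma ideal_init_sum i (J : Type) (s : seq J) (P : pred J) (F : J -> A) :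
  (forall j, P j -> F j \in ideal_init x i) ->
  \sum_(j <- s | P j) F j \in ideal_init x i.
Proof.
move=> h; elim/big_rec: _ => [|j u Pj uI]; first exact: ideal_init0.
by apply: ideal_initD => //; apply: h.
Qed.

Lemma ideal_initX i (j : 'I_n) : (j < i)%N -> x j \in ideal_init x i.
Proof.
move=> ji; apply/asboolP; exists (fun l => (l == j)%:R).
rewrite (bigD1 j) //= eqxx mul1r big1 ?addr0 // => l /andP[_ /negPf ->].
by rewrite mul0r.
Qed.

Lemma ideal_init_le i j u :
  (i <= j)%N -> u \in ideal_init x i -> u \in ideal_init x j.
Proof.
move=> ij /asboolP[c ->]; apply: ideal_init_sum => l li.
by apply/ideal_initM/ideal_initX/(leq_trans li).
Qed.

Lemma ideal_init_gen : ideal_init x n =i ideal_gen x.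
Proof.
move=> u; apply: asbool_equiv_eq; split=> -[c ->]; exists c;
  by apply: eq_bigl => j; rewrite ltn_ord.
Qed.

Lemma ideal_initS (i : 'I_n) u : u \in ideal_init x i.+1 ->
  exists a, u - a * x i \in ideal_init x i.
Proof.
move=> /asboolP[c ->]; exists (c i).
have -> : \sum_(j < n | (j < i.+1)%N) c j * x j - c i * x i =
    \sum_(j < n | (j < i)%N) c j * x j.
  rewrite (bigD1 i) ?ltnSn //= addrAC subrr add0r.
  by apply: eq_bigl => j; rewrite ltnS ltn_neqAle andbC.
by apply/asboolP; exists c.
Qed.

(** Quasi-regularity is proved by induction on the length of the sequence.  The
   forms in the first i variables are kept in the polynomial ring in all
   variables, so that the induction does not change their type. *)
Definition mon_init i d m :=
  (mdeg m == d) && [forall j : 'I_n, (i <= j)%N ==> (m j == 0%N)].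
Definition hom_init i d F := forall m, ~~ mon_init i d m -> F@_m = 0.

Lemma hom_init0 i d : hom_init i d 0.
Proof. by move=> m _; rewrite mcoeff0. Qed.

Lemma hom_initZD i d c F G :
  hom_init i d F -> hom_init i d G -> hom_init i d (c *: F + G).
Proof.
by move=> hF hG m mN; rewrite mcoeffD mcoeffZ hF // hG // mulr0 addr0.
Qed.

Lemma hom_initZ i d c F : hom_init i d F -> hom_init i d (c *: F).
Proof. by move=> hF m mN; rewrite mcoeffZ hF // mulr0. Qed.

Lemma hom_initD i d F G :
  hom_init i d F -> hom_init i d G -> hom_init i d (F + G).
Proof. by move=> hF hG m mN; rewrite mcoeffD hF // hG // addr0. Qed.

Lemma hom_initB i d F G :
  hom_init i d F -> hom_init i d G -> hom_init i d (F - G).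
Proof. by move=> hF hG m mN; rewrite mcoeffB hF // hG // subr0. Qed.

Lemma hom_init_sum i d (J : Type) (s : seq J) (P : pred J)
    (F : J -> {mpoly A[n]}) :
  (forall j, P j -> hom_init i d (F j)) ->
  hom_init i d (\sum_(j <- s | P j) F j).
Proof.
move=> h; apply: big_rec => [|j u Pj]; first exact: hom_init0.
exact/hom_initD/h.
Qed.

Lemma hom_initX i d m : mon_init i d m -> hom_init i d 'X_[m].
Proof.
by move=> md m' m'N; rewrite mcoeffX; case: eqP => // e; rewrite -e md in m'N.
Qed.

Lemma hom_init_le i j d F : (i <= j)%N -> hom_init i d F -> hom_init j d F.
Proof.
move=> ij hF m mN; apply: hF; apply: contra mN.
rewrite /mon_init => /andP[-> /forallP h] /=; apply/forallP => l.
by apply/implyP => jl; apply: (implyP (h l)); apply: leq_trans jl.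
Qed.

Lemma mon_initD i d m (j : 'I_n) : (j < i)%N ->
  mon_init i d.+1 (m + U_(j))%MM = mon_init i d m.
Proof.
move=> ji; rewrite /mon_init mdegD mdeg1 addn1 eqSS; congr (_ && _).
apply: eq_forallb => l; rewrite mnmDE mnm1E.
have [/= il|//] := leqP i l; case: (j =P l) => [e|_]; last by rewrite addn0.
by rewrite -e leqNgt ji in il.
Qed.

Lemma mon_initS i d m : mon_init i d.+1 m ->
  exists2 j : 'I_n, (j < i)%N & exists m', m = (m' + U_(j))%MM.
Proof.
move=> /andP[/eqP md /forallP mi].
have /existsP[j mj] : [exists j, (0 < m j)%N].
  apply: contraT; rewrite negb_exists => /forallP h.
  move: md; rewrite mdegE big1 // => j _; apply/eqP.
  by have := h j; rewrite -eqn0Ngt.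
exists j.
  rewrite ltnNge; apply/negP => ij.
  by have := implyP (mi j) ij; rewrite eqn0Ngt mj.
exists (m - U_(j))%MM; rewrite submK //; apply/mnm_lepP => l; rewrite mnm1E.
by case: eqP => // <-.
Qed.

(** A property stable under sums is checked on single terms; [C] carries to the
   terms what is known of the coefficients. *)
Lemma hom_init_ind i d (C : A -> Prop) (P : {mpoly A[n]} -> Prop) :
  P 0 -> (forall F G, P F -> P G -> P (F + G)) ->
  (forall c m, C c -> mon_init i d m -> P (c *: 'X_[m])) ->
  forall F, hom_init i d F -> (forall m, C F@_m) -> P F.
Proof.
move=> P0 PD PX F hF CF; rewrite [F]mpolyE big_seq; apply: big_ind => // m mF.
apply: PX => //; apply/negPn/negP => /hF F0.
by rewrite mcoeff_msupp F0 eqxx in mF.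
Qed.

Lemma hom_initMX i d (j : 'I_n) F : (j < i)%N ->
  hom_init i d F -> hom_init i d.+1 (F * 'X_j).
Proof.
move=> ji hF; apply: (hom_init_ind (d := d) (i := i) (C := fun=> True)
  (P := fun F => hom_init i d.+1 (F * 'X_j))) hF _ => //.
- by rewrite mul0r; apply: hom_init0.
- by move=> G H hG hH; rewrite mulrDl; apply: hom_initD.
move=> c m _ md; rewrite -scalerAl; apply: hom_initZ.
by rewrite -mpolyXD; apply: hom_initX; rewrite mon_initD.
Qed.

(** In each monomial of G, one variable is replaced by its value. *)
Lemma hom_init_lower i d G : hom_init i d.+1 G ->
  exists F, [/\ hom_init i d F, F.@[x] = G.@[x]
              & forall m, F@_m \in ideal_init x i].
Proof.
move=> hG; apply: (hom_init_ind (C := fun=> True)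
  (P := fun G => exists F, [/\ hom_init i d F, F.@[x] = G.@[x]
              & forall m, F@_m \in ideal_init x i])) hG _ => //.
- exists 0; split=> [||m]; [exact: hom_init0|by rewrite !meval0|].
  by rewrite mcoeff0 ideal_init0.
- move=> G1 G2 [F1 [h1 e1 c1]] [F2 [h2 e2 c2]]; exists (F1 + F2); split.
  + exact: hom_initD.
  + by rewrite !mevalD e1 e2.
  by move=> m; rewrite mcoeffD ideal_initD.
move=> c m _ md; have [j ji [m' e]] := mon_initS md.
exists ((c * x j) *: 'X_[m']); split.
- by apply/hom_initZ/hom_initX; move: md; rewrite e mon_initD.
- by rewrite e mpolyXD !mevalZ mevalM mevalXU mulrCA mulrA mulrC mulrA.
by move=> l; rewrite mcoeffZ mulrAC ideal_initM // ideal_initX.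
Qed.

(** The converse of [hom_init_lower]: coefficients in the ideal turn into one
   more variable. *)
Lemma hom_init_raise i d F : hom_init i d F ->
  (forall m, F@_m \in ideal_init x i) ->
  exists2 G, hom_init i d.+1 G & G.@[x] = F.@[x].
Proof.
apply: (hom_init_ind (C := fun c => c \in ideal_init x i)
  (P := fun F => exists2 G, hom_init i d.+1 G & G.@[x] = F.@[x])).
- by exists 0; [exact: hom_init0|].
- move=> F1 F2 [G1 h1 e1] [G2 h2 e2]; exists (G1 + G2); first exact: hom_initD.
  by rewrite !mevalD e1 e2.
move=> c m /asboolP[b ->] md.
exists (\sum_(j < n | (j < i)%N) b j *: ('X_[m] * 'X_j)).
  by apply: hom_init_sum => j ji; apply/hom_initZ/hom_initMX/hom_initX.
rewrite raddf_sum mevalZ mulr_suml; apply: eq_bigr => j _ /=.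
by rewrite mevalZ mevalM mevalXU mulrA mulrAC.
Qed.

Lemma hom_init_split (i : 'I_n) d F : hom_init i.+1 d.+1 F ->
  exists G H, [/\ hom_init i d.+1 G, hom_init i.+1 d H & F = G + H * 'X_i].
Proof.
move=> hF; apply: (hom_init_ind (C := fun=> True)
  (P := fun F => exists G H,
     [/\ hom_init i d.+1 G, hom_init i.+1 d H & F = G + H * 'X_i])) hF _ => //.
- by exists 0, 0; split; rewrite ?mul0r ?addr0 //; apply: hom_init0.
- move=> F1 F2 [G1 [H1 [g1 h1 ->]]] [G2 [H2 [g2 h2 ->]]].
  exists (G1 + G2), (H1 + H2); split; try exact: hom_initD.
  by rewrite mulrDl addrACA.
move=> c m _ md; have [mi|mi] := eqVneq (m i) 0%N.
  exists (c *: 'X_[m]), 0.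
  split; rewrite ?mul0r ?addr0 //; last exact: hom_init0.
  apply/hom_initZ/hom_initX; case/andP: md => md /forallP h.
  rewrite /mon_init md /=.
  apply/forallP => j; apply/implyP; rewrite leq_eqVlt => /orP[/eqP e|].
    by rewrite -mi; apply/eqP; congr (m _); apply: val_inj.
  exact: (implyP (h j)).
have e : m = (m - U_(i) + U_(i))%MM.
  rewrite submK //; apply/mnm_lepP => l; rewrite mnm1E.
  by case: eqP => // <-; rewrite lt0n.
exists 0, (c *: 'X_[m - U_(i)]); split; first exact: hom_init0.
  by apply/hom_initZ/hom_initX; move: md; rewrite {1}e mon_initD.
by rewrite add0r -scalerAl -mpolyXD -e.
Qed.

Definition quasi_regular_init i d := forall F, hom_init i d F -> F.@[x] = 0 ->
  forall m, F@_m \in ideal_init x i.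

Lemma quasi_regular0 i : quasi_regular_init i 0.
Proof.
move=> F hF eF m; suff -> : F = 0 by rewrite mcoeff0 ideal_init0.
have eFC : F = (F@_0%MM)%:MP.
  apply/mpolyP => l; rewrite mcoeffC; have [->|l0] := eqVneq l 0%MM.
    by rewrite mulr1.
  by rewrite mulr0 hF // /mon_init mdeg_eq0 (negPf l0).
by move: eF; rewrite eFC mevalC => ->.
Qed.

(** Two forms of degrees d and d + 1 with the same value: after
   [hom_init_lower], their difference is a form of degree d vanishing at x. *)
Lemma quasi_regular_initS i d F G : quasi_regular_init i d ->
  hom_init i d F -> hom_init i d.+1 G -> F.@[x] = G.@[x] ->
  forall m, F@_m \in ideal_init x i.
Proof.
move=> qr hF /hom_init_lower[G' [hG' eG' cG']] e m.
rewrite -[F@_m](subrK (G'@_m)); apply: ideal_initD => //.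
rewrite -mcoeffB; apply: qr; first exact: hom_initB.
by rewrite mevalB eG' e subrr.
Qed.

(** A nonzerodivisor modulo I = (x_0, ..., x_(i-1)) remains one modulo I^d,
   because the associated graded ring is a polynomial ring over A / I. *)
Lemma nzd_pow i z : (forall d, quasi_regular_init i d) ->
  (forall r, z * r \in ideal_init x i -> r \in ideal_init x i) ->
  forall d u, (exists2 G, hom_init i d G & G.@[x] = z * u) ->
  exists2 F, hom_init i d F & F.@[x] = u.
Proof.
move=> qr zreg; elim=> [|d IHd] u [G hG eG].
  exists (u%:MP); last by rewrite mevalC.
  move=> m; rewrite mcoeffC; case: eqP => [->|_]; last by rewrite mulr0.
  rewrite /mon_init mdeg0 eqxx negb_forall => /existsP[j].
  by rewrite mnm0E implybT.
have [G' [hG' eG' _]] := hom_init_lower hG.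
have [|F hF eF] := IHd u; first by exists G'; rewrite ?eG'.
have [|G1 hG1 eG1] := @hom_init_raise i d F hF; last by exists G1; rewrite ?eG1.
move=> m; apply: zreg; rewrite -mcoeffZ.
apply: (quasi_regular_initS (qr d)) hG _ _; first exact: hom_initZ.
by rewrite mevalZ eF eG.
Qed.

(** For F of degree d + 1, write F = G + H X_i with G free of X_i.  As F vanishes
   at x, H(x) lies in I^(d+1) by [nzd_pow], where I = (x_0, ..., x_(i-1)); so the
   coefficients of H lie in (I, x_i) by induction on the degree.  If K is a form
   of degree d + 1 in the first i variables with K(x) = H(x), then G + x_i K
   vanishes at x, hence has its coefficients in I, and those of G lie in
   (I, x_i). *)
Lemma quasi_regular_step (i : 'I_n) :
  (forall r, x i * r \in ideal_init x i -> r \in ideal_init x i) ->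
  (forall d, quasi_regular_init i d) -> forall d, quasi_regular_init i.+1 d.
Proof.
move=> xreg qr; elim=> [|d IHd] F hF eF m.
  exact: quasi_regular0 hF eF m.
have [G [H [hG hH eGH]]] := hom_init_split hF.
have [|K hK eK] := nzd_pow qr xreg (d := d.+1) (u := H.@[x]).
  exists (- 1 *: G); first exact: hom_initZ.
  apply/eqP; rewrite mevalZ mulN1r eq_sym -addr_eq0; apply/eqP.
  by rewrite addrC mulrC -eF eGH mevalD mevalM mevalXU.
have cH l : H@_l \in ideal_init x i.+1.
  apply: (quasi_regular_initS IHd) hH (hom_init_le (leqnSn i) hK) _ l.
  by rewrite eK.
have cG l : G@_l \in ideal_init x i.+1.
  have cGK : G@_l + x i * K@_l \in ideal_init x i.
    rewrite -mcoeffZ -mcoeffD; apply: (qr d.+1).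
      by rewrite addrC; apply: hom_initZD.
    by rewrite mevalD mevalZ eK mulrC -eF eGH mevalD mevalM mevalXU.
  rewrite -[G@_l](addrK (x i * K@_l)) ideal_initB //.
    exact: ideal_init_le cGK.
  by rewrite mulrC ideal_initM // ideal_initX.
rewrite eGH mcoeffD ideal_initD // mcoeffM.
by apply: ideal_init_sum => l _; rewrite mulrC ideal_initM.
Qed.

Lemma regular_quasi_regular i : regular_seq x -> (i <= n)%N ->
  forall d, quasi_regular_init i d.
Proof.
move=> [xreg _]; elim: i => [_ d F hF|i IHi lin].
  case: d hF => [|d] hF; first exact: quasi_regular0.
  by move=> _ m; rewrite hF ?ideal_init0 //; apply/negP => /mon_initS[j].
exact: (quasi_regular_step (i := Ordinal lin)) (xreg _) (IHi (ltnW lin)).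
Qed.

End QuasiRegular.

(** * Powers of an ideal acting on free modules *)

Section DualBasis.
Variables (A : comNzRingType) (M : lmodType A).

(** The coordinate forms of a basis, indexed by all of M and zero outside of the
   basis; the basis may be infinite, but each sum is finite. *)
Lemma free_dual_basis : is_free M -> exists coord : M -> M -> A,
  (forall b a u v, coord b (a *: u + v) = a * coord b u + coord b v) /\
  (forall v, exists s : seq M, v = \sum_(b <- s) coord b v *: b).
Proof.
move=> [B [span indep]].
have suppP v : exists sc : seq M * (M -> A),
    [/\ uniq sc.1, forall b, b \in sc.1 -> B b
       & v = \sum_(b <- sc.1) sc.2 b *: b].
  have [s [c [sB ->]]] := span v.
  (* A repeated basis vector contributes its coefficient once per occurrence. *)
  exists (undup s, fun b => c b *+ count_mem b s); split=> /=.
  - exact: undup_uniq.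
  - by move=> b; rewrite mem_undup; apply: sB.
  rewrite -(big_undup_iterop_count +%R).
  apply: eq_bigr => b _.
  by rewrite Monoid.iteropE iter_addr_0 scalerMnl.
have [sc scP] := choice suppP.
pose coord b v := if b \in (sc v).1 then (sc v).2 b else 0.
have coordE s v : uniq s -> {subset (sc v).1 <= s} ->
    v = \sum_(b <- s) coord b v *: b.
  move=> us sub; have [u1 _ e] := scP v.
  rewrite (bigID (fun b => b \in (sc v).1)) /= [X in _ + X]big1 ?addr0.
    2: by move=> b; rewrite /coord => /negPf ->; rewrite scale0r.
  rewrite {1}e -[RHS]big_filter.
  rewrite [RHS](perm_big (sc v).1) /=; last first.
    apply: uniq_perm; rewrite ?filter_uniq // => b.
    by rewrite mem_filter andb_idr // => /sub.
  by rewrite !big_seq; apply: eq_bigr => b bs; rewrite /coord bs.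
exists coord; split=> [b a u v|v]; last first.
  by exists (sc v).1; apply: coordE => //; case: (scP v).
set w := a *: u + v.
pose s := undup ((sc u).1 ++ (sc v).1 ++ (sc w).1).
have us : uniq s by apply: undup_uniq.
have mems y : (y \in s) = [|| y \in (sc u).1, y \in (sc v).1 | y \in (sc w).1].
  by rewrite mem_undup !mem_cat.
have [bs|bs] := boolP (b \in s); last first.
  move: bs; rewrite mems !negb_or /coord.
  move=> /and3P[/negPf -> /negPf -> /negPf ->].
  by rewrite mulr0 addr0.
have sB y : y \in s -> B y.
  have [[_ h1 _] [_ h2 _]] := (scP u, scP v); have [_ h3 _] := scP w.
  by rewrite mems => /or3P[/h1|/h2|/h3].
have := indep s (fun b => coord b w - (a * coord b u + coord b v)) us sB.
move=> /(_ _ b bs) h; apply/eqP; rewrite -subr_eq0; apply/eqP/h.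
under eq_bigr => y _ do rewrite scalerBl scalerDl -scalerA.
rewrite sumrB big_split -scaler_sumr /=.
by rewrite -!coordE ?subrr // => y; rewrite mems => ->; rewrite ?orbT.
Qed.

End DualBasis.

Section ModulePowers.
Variables (A : comNzRingType) (n : nat) (x : 'I_n -> A).
Local Notation mon := (mmap1 x).

Section OneModule.
Variable M : lmodType A.
Implicit Types (c : 'X_{1..n} -> M) (u v : M).

(** The value at x of the form of degree d with coefficients [c] in M. *)
Definition hsum d c : M :=
  \sum_(m : 'X_{1..n < d.+1} | mdeg m == d) mon m *: c m.

Definition pow_mod d v := exists c, v = hsum d c.

Definition gen_mod v := exists w : 'I_n -> M, v = \sum_i x i *: w i.

Lemma hsumD d c c' : hsum d (fun m => c m + c' m) = hsum d c + hsum d c'.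
Proof. by rewrite -big_split; apply: eq_bigr => m _; rewrite scalerDr. Qed.

Lemma hsumZ d a c : hsum d (fun m => a *: c m) = a *: hsum d c.
Proof. by rewrite scaler_sumr; apply: eq_bigr => m _; rewrite !scalerA mulrC. Qed.

Lemma hsum0 c : hsum 0 c = c 0%MM.
Proof.
rewrite /hsum (bigD1 bm0) ?mdeg0 //= mmap11 scale1r big1 ?addr0 // => m.
by rewrite mdeg_eq0 => /andP[/eqP m0 /eqP[]]; apply: val_inj.
Qed.

Lemma pow_mod0 v : pow_mod 0 v.
Proof. by exists (fun=> v); rewrite hsum0. Qed.

Lemma pow_mod_zero d : pow_mod d 0.
Proof. by exists (fun=> 0); rewrite /hsum big1 // => m _; rewrite scaler0. Qed.

Lemma pow_modD d u v : pow_mod d u -> pow_mod d v -> pow_mod d (u + v).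
Proof. by move=> [c ->] [c' ->]; exists (fun m => c m + c' m); rewrite hsumD. Qed.

Lemma pow_modZ d a v : pow_mod d v -> pow_mod d (a *: v).
Proof. by move=> [c ->]; exists (fun m => a *: c m); rewrite hsumZ. Qed.

Lemma pow_modB d u v : pow_mod d u -> pow_mod d v -> pow_mod d (u - v).
Proof. by move=> hu hv; rewrite -scaleN1r; apply/pow_modD/pow_modZ. Qed.

Lemma pow_mod_sum d (J : Type) (s : seq J) (P : pred J) (F : J -> M) :
  (forall j, P j -> pow_mod d (F j)) -> pow_mod d (\sum_(j <- s | P j) F j).
Proof.
move=> h; apply: big_rec => [|j u Pj hu]; last exact: pow_modD (h j Pj) hu.
exact: pow_mod_zero.
Qed.

Lemma pow_mod_mon d m v : mdeg m = d -> pow_mod d (mon m *: v).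
Proof.
move=> <-; exists (fun p => if p == m then v else 0).
rewrite /hsum (bigD1 (BMultinom (leqnn (mdeg m).+1))) //= eqxx big1 ?addr0 //.
move=> p /andP[_ pm]; case: eqP => [e|_]; last exact: scaler0.
by case/eqP: pm; apply: val_inj.
Qed.

Lemma mon_mulU m i : mon (m + U_(i))%MM = mon m * x i.
Proof. by rewrite commr_mmap1_M ?mmap1U // => ? ?; exact: mulrC. Qed.

Lemma pow_mod_hsum d c : (forall m, mdeg m = d -> gen_mod (c m)) ->
  pow_mod d.+1 (hsum d c).
Proof.
move=> h; apply: pow_mod_sum => m /eqP md; have [w ->] := h m md.
rewrite scaler_sumr; apply: pow_mod_sum => i _.
rewrite scalerA -mon_mulU; apply: pow_mod_mon.
by rewrite mdegD mdeg1 md addn1.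
Qed.

Lemma pow_modS d v : pow_mod d.+1 v -> pow_mod d v.
Proof.
move=> [c ->]; apply: pow_mod_sum => m md.
have [|j _ [m' e]] := @mon_initS n n d m.
  by rewrite /mon_init md; apply/forallP => j; rewrite leqNgt ltn_ord.
rewrite e mon_mulU -scalerA; apply: pow_mod_mon.
by move: md; rewrite e mdegD mdeg1 addn1 eqSS => /eqP.
Qed.

Lemma pow_mod_le d e v : (d <= e)%N -> pow_mod e v -> pow_mod d v.
Proof.
move=> /subnKC <-; elim: (e - d)%N => [|j IHj]; first by rewrite addn0.
by rewrite addnS => /pow_modS.
Qed.

Lemma gen_mod_coord (coord : M -> M -> A) v :
  (forall v, exists s : seq M, v = \sum_(b <- s) coord b v *: b) ->
  (forall b, coord b v \in ideal_gen x) -> gen_mod v.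
Proof.
move=> coordE cI; have [s ->] := coordE v; elim: s => [|b s [w ew]].
  by exists (fun=> 0); rewrite big_nil big1 // => i _; rewrite scaler0.
have /asboolP[a ea] := cI b.
exists (fun i => a i *: b + w i); rewrite big_cons ew ea scaler_suml -big_split /=.
by apply: eq_bigr => i _; rewrite scalerDr scalerA mulrC.
Qed.

(** Quasi-regularity on a free module is quasi-regularity of the ring, read on
   the coordinates. *)
Lemma free_quasi_regular : regular_seq x -> is_free M ->
  forall d c, pow_mod d.+1 (hsum d c) -> forall m, mdeg m = d -> gen_mod (c m).
Proof.
move=> xreg /free_dual_basis[coord [coordl coordE]] d c [c' e] m md.
have coordD b u v : coord b (u + v) = coord b u + coord b v.
  by rewrite -[u]scale1r coordl mul1r scale1r.
have coord0 b : coord b 0 = 0.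
  by apply: (addrI (coord b 0)); rewrite -coordD !addr0.
have coordZ b a v : coord b (a *: v) = a * coord b v.
  by rewrite -[a *: v]addr0 coordl coord0 addr0.
pose F b k (g : 'X_{1..n} -> M) : {mpoly A[n]} := \sum_(p : 'X_{1..n < k.+1})
  (if mdeg p == k then coord b (g p) else 0) *: 'X_[p].
have hF b k g : hom_init n k (F b k g).
  apply: hom_init_sum => p _; case: eqP => [pk|_]; last first.
    by rewrite scale0r; apply: hom_init0.
  apply/hom_initZ/hom_initX; rewrite /mon_init pk eqxx.
  by apply/forallP => j; rewrite leqNgt ltn_ord.
have eF b k g : (F b k g).@[x] = coord b (hsum k g).
  rewrite /F /hsum (big_morph (coord b) (coordD b) (coord0 b)).
  rewrite raddf_sum [RHS]big_mkcond /=; apply: eq_bigr => p _.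
  rewrite mevalZ mevalX; case: eqP => _; last by rewrite mul0r.
  by rewrite coordZ mulrC.
have cI b : coord b (c m) \in ideal_init x n.
  have -> : coord b (c m) = (F b d c)@_m.
    rewrite (mcoeff_mpoly (fun p => if mdeg p == d then coord b (c p) else 0)).
      by rewrite md eqxx.
    by rewrite md.
  apply: (quasi_regular_initS (regular_quasi_regular xreg (leqnn n) (d := d)))
    (hF b d c) (hF b d.+1 c') _ _.
  by rewrite !eF e.
apply: (gen_mod_coord coordE) => b; rewrite -ideal_init_gen; exact: cI.
Qed.

End OneModule.

Lemma hsum_linear (M N : lmodType A) (h : {linear M -> N}) d c :
  h (hsum d c) = hsum d (fun m => h (c m)).
Proof. by rewrite raddf_sum; apply: eq_bigr => m _ /=; rewrite linearZ. Qed.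

End ModulePowers.

(** * Base change along a surjection *)

(** The map phi : L -> F has the universal property of the base change of L.
   Testing it on the image of phi shows that phi is onto; testing it, for L
   free, on the coordinate forms of L shows that its kernel is ker(pi) L. *)

Section BaseChange.
Variables (R Rbar : comNzRingType) (pi : {rmorphism R -> Rbar}).
Hypothesis pi_surj : forall q, exists r, q = pi r.
Variables (L : lmodType R) (F : lmodType Rbar).
Variable phi : {linear L -> F | pi \; *:%R}.

Definition bc_image : {pred F} := [pred w | `[< exists v, w = phi v >]].

Fact bc_image_submod : submod_closed bc_image.
Proof.
split=> [|q u v /asboolP[u' ->] /asboolP[v' ->]]; apply/asboolP.
  by exists 0; rewrite raddf0.
have [r ->] := pi_surj q.
by exists (r *: u' + v'); rewrite linearP.
Qed.
HB.instance Definition _ := GRing.isSubmodClosed.Build Rbar F bc_image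
  bc_image_submod.

Definition bc_image_type : Type := {w : F | w \in bc_image}.
HB.instance Definition _ := SubType.on bc_image_type.
HB.instance Definition _ := Choice.on bc_image_type.
HB.instance Definition _ := [SubChoice_isSubLmodule of bc_image_type by <:].

Fact bc_image_in v : phi v \in bc_image.
Proof. by apply/asboolP; exists v. Qed.
Definition bc_corestr (v : L) : bc_image_type :=
  exist _ (phi v) (bc_image_in v).

Fact bc_corestr_zmod : zmod_morphism bc_corestr.
Proof. by move=> u v; apply: val_inj; rewrite /= raddfB. Qed.
HB.instance Definition _ := GRing.isZmodMorphism.Build L bc_image_type
  bc_corestr bc_corestr_zmod.
Fact bc_corestr_scale : scalable_for (pi \; *:%R) bc_corestr.
Proof. by move=> r v; apply: val_inj; rewrite /= linearZ. Qed.
HB.instance Definition _ := GRing.isScalable.Build R L bc_image_type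
  (pi \; *:%R) bc_corestr bc_corestr_scale.

Definition bc_incl (w : bc_image_type) : F := val w.
Fact bc_incl_linear : linear bc_incl.
Proof. by []. Qed.
HB.instance Definition _ := GRing.isLinear.Build Rbar bc_image_type F *:%R
  bc_incl bc_incl_linear.

Lemma base_change_surj : base_change phi -> forall w, exists v, w = phi v.
Proof.
move=> bc w; have [g [gphi _]] := bc _ bc_corestr.
have [i [_ iU]] := bc _ phi.
(* Both the identity and the retraction of F onto the image extend phi. *)
have : (bc_incl \o g) w = idfun w.
  by rewrite (iU (bc_incl \o g)) ?(iU idfun) // => v; rewrite /= gphi.
by move=> /= <-; apply/asboolP; apply: (valP (g w)).
Qed.

End BaseChange.

Section BaseChangeKernel.
Variables (R Rbar : comNzRingType) (pi : {rmorphism R -> Rbar}).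
Variables (L : lmodType R) (F : lmodType Rbar).
Variable phi : {linear L -> F | pi \; *:%R}.
Variable h : L -> R.
Hypothesis h_linear : forall a u v, h (a *: u + v) = a * h u + h v.

Definition bc_form (v : L) : Rbar^o := pi (h v).

Fact bc_form_linear : linear_for (pi \; *:%R) bc_form.
Proof. by move=> a u v; rewrite /bc_form h_linear rmorphD rmorphM. Qed.
HB.instance Definition _ := GRing.isLinear.Build R L Rbar^o (pi \; *:%R) bc_form
  bc_form_linear.

Lemma base_change_form v : base_change phi -> phi v = 0 -> pi (h v) = 0.
Proof.
by move=> /(_ _ bc_form)[g [gphi _]] pv; rewrite -[LHS]gphi pv raddf0.
Qed.

End BaseChangeKernel.

Lemma base_change_ker (R Rbar : comNzRingType) (pi : {rmorphism R -> Rbar})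
    (n : nat) (x : 'I_n -> R) (L : lmodType R) (F : lmodType Rbar)
    (phi : {linear L -> F | pi \; *:%R}) v :
  (forall r, pi r = 0 -> r \in ideal_gen x) -> is_free L -> base_change phi ->
  phi v = 0 -> gen_mod x v.
Proof.
move=> kerpi /free_dual_basis[coord [coordl coordE]] bc pv.
apply: (gen_mod_coord coordE) => b.
exact/kerpi/(base_change_form (coordl b) bc pv).
Qed.

(** * Retractions from ideal complements *)

(** A subalgebra S and an ideal J with R = S + J and S meeting J in 0: the
   projection of R onto S along J is a morphism of algebras because J is an
   ideal. *)
Section Complement.
Variables (k : fieldType) (R : augAlg k) (S : subalgClosed R) (J : R -> Prop).
Hypothesis J_ideal : forall a u v, J u -> J v -> J (a * u + v).
Hypothesis J_max : forall u, J u -> u \in aug_max R.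
Hypothesis J_total : forall r, exists2 f, f \in S & J (r - f).
Hypothesis J_inter : forall f, f \in S -> J f -> f = 0.

Local Lemma J0 : J 0.
Proof.
have [f _ Jf] := J_total 0.
by have := J_ideal (-1) Jf Jf; rewrite mulN1r addNr.
Qed.

Local Lemma J_lin (c : k) u v : J u -> J v -> J (c *: u + v).
Proof. by move=> hu hv; rewrite -[u]mul1r scalerAl; apply: J_ideal. Qed.

Fact compl_ex r : exists f : sub_aug S, J (r - sub_incl f).
Proof. by have [f fS Jf] := J_total r; exists (exist _ f fS). Qed.

Definition compl_proj r : sub_aug S := projT1 (cid (compl_ex r)).

Lemma compl_projP r : J (r - sub_incl (compl_proj r)).
Proof. exact: (projT2 (cid (compl_ex r))). Qed.

Lemma compl_proj_uniq r f : J (r - sub_incl f) -> compl_proj r = f.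
Proof.
move=> Jf; apply: val_inj; apply/eqP; rewrite -subr_eq0; apply/eqP.
apply: J_inter; first by rewrite -scaleN1r rpredD ?rpredZ //; apply: valP.
have := J_ideal (-1) (compl_projP r) Jf.
by rewrite mulN1r opprB addrA subrK.
Qed.

Fact compl_proj_zmod : zmod_morphism compl_proj.
Proof.
move=> r s; apply: compl_proj_uniq.
have := J_ideal (-1) (compl_projP s) (compl_projP r).
congr J; rewrite rmorphB; ring.
Qed.

Fact compl_proj_monoid : monoid_morphism compl_proj.
Proof.
split=> [|r s]; apply: compl_proj_uniq.
  by rewrite rmorph1 subrr; apply: J0.
have := J_ideal r (compl_projP s)
  (J_ideal (sub_incl (compl_proj s)) (compl_projP r) J0).
congr J; rewrite rmorphM; ring.
Qed.

Fact compl_proj_scale : scalable compl_proj.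
Proof.
move=> c r; apply: compl_proj_uniq.
have := J_lin c (compl_projP r) J0.
by congr J; rewrite addr0 scalerBr linearZ.
Qed.

HB.instance Definition _ := GRing.isZmodMorphism.Build R (sub_aug S) compl_proj
  compl_proj_zmod.
HB.instance Definition _ := GRing.isMonoidMorphism.Build R (sub_aug S) compl_proj
  compl_proj_monoid.
HB.instance Definition _ := GRing.isScalable.Build k R (sub_aug S) *:%R compl_proj
  compl_proj_scale.

Lemma compl_retraction :
  is_retraction (@sub_incl k R S : {lrmorphism sub_aug S -> R}) compl_proj.
Proof.
have K : cancel (@sub_incl k R S) compl_proj.
  by move=> f; apply: compl_proj_uniq; rewrite subrr; apply: J0.
split=> //.
- move=> r rm; rewrite in_sub_max -[sub_incl _](subrK r) addrC rpredD //.
  by rewrite -opprB rpredN; apply/J_max/compl_projP.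
- exact: can_inj K.
by move=> a; exists (sub_incl a).
Qed.

End Complement.

(** * Liftings of the residue field give retractions *)

Lemma aug_res_scalar (k : fieldType) (A : augAlg k) (c : k) :
  aug_res (c%:A : A) = c.
Proof. by apply: aug_res_uniq; rewrite subrr; case: (aug_ideal A). Qed.

Section PartialSums.
Variables (k : fieldType) (R : augAlg k) (n : nat) (x : 'I_n -> maxid R).
Local Notation mon := (mmap1 (fun i => val (x i))).
Implicit Types a : 'X_{1..n} -> k.

Lemma psumS a N :
  psum x a N.+1 =
  psum x a N + \sum_(m : 'X_{1..n < N.+1} | mdeg m == N) a m *: mon m.
Proof.
rewrite {1}/psum (bigID (fun m : 'X_{1..n < N.+1} => mdeg m == N)) /= addrC.
congr (_ + _); rewrite /psum.
pose f (m : 'X_{1..n}) := a m *: mon m.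
have e M : \sum_(m : 'X_{1..n < M}) f m =
    \sum_(p <- map (@bmnm n M) (index_enum _)) f p by rewrite big_map.
(* Multi-indices bounded by N and by N.+1 have different types, so the sums are
   compared over the underlying multi-indices. *)
rewrite e -big_filter -(big_map (@bmnm n N.+1) xpredT f).
apply: perm_big; apply: uniq_perm.
- by rewrite map_inj_uniq ?filter_uniq ?index_enum_uniq //; apply: val_inj.
- by rewrite map_inj_uniq ?index_enum_uniq //; apply: val_inj.
move=> m; apply/mapP/mapP => -[p].
  rewrite mem_filter => /andP[pN _ ->].
  have pN' : (mdeg p < N)%N by rewrite ltn_neqAle pN -ltnS bmdeg.
  by exists (BMultinom pN'); rewrite ?mem_index_enum.
move=> _ ->; exists (BMultinom (leqW (bmdeg p))) => //.
by rewrite mem_filter mem_index_enum /= ltn_eqF ?bmdeg.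
Qed.

Lemma psumB a b N : psum x (fun m => a m - b m) N = psum x a N - psum x b N.
Proof. by rewrite -sumrB; apply: eq_bigr => m _; rewrite scalerBl. Qed.

Lemma psum_le a N M : (N <= M)%N ->
  psum x a M - psum x a N \in ideal_pow (aug_max R) N.
Proof.
move=> NM; rewrite -!peval_trunc; apply: peval_congr => m mN.
by rewrite !mcoeff_trunc // (leq_trans mN).
Qed.

Lemma eq_psum a b N : (forall m, (mdeg m < N)%N -> a m = b m) ->
  psum x a N = psum x b N.
Proof. by move=> e; apply: eq_bigr => m _; rewrite e // bmdeg. Qed.

End PartialSums.

Section Lifted.
Variables (k : fieldType) (R : augAlg k) (n : nat) (x : 'I_n -> maxid R).
Local Notation xv := (fun i => val (x i)).

(** The terms of degree at most 2 of a complex whose reduction modulo x is exact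
   in degree 1 and has homology k, through [eps], in degree 0. *)
Variables (L0 L1 L2 : lmodType R).
Variables (d1 : {linear L1 -> L0}) (d2 : {linear L2 -> L1}).
Variables (eps : L0 -> k) (e : L0).
Hypothesis d12 : forall v, d1 (d2 v) = 0.
Hypothesis exact1 :
  forall u, gen_mod xv (d1 u) -> exists v, gen_mod xv (u - d2 v).
Hypothesis epsB : forall l l', eps (l - l') = eps l - eps l'.
Hypothesis epsZ : forall r l, eps (r *: l) = aug_res r * eps l.
Hypothesis eps_e : eps e = 1.
Hypothesis eps_exact : forall l, eps l = 0 <-> exists u, gen_mod xv (l - d1 u).
Hypothesis free0 : is_free L0.
Hypothesis x_regular : regular_seq xv.
Hypothesis R_complete : aug_complete R.

(** The preimage in L0 of (x)^D N, where N is the cokernel of d1. *)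
Definition filt D l := exists u, pow_mod xv D (l - d1 u).

Lemma filtD D l l' : filt D l -> filt D l' -> filt D (l + l').
Proof.
move=> [u hu] [u' hu']; exists (u + u').
by rewrite raddfD opprD addrACA; apply: pow_modD.
Qed.

Lemma filtZ D r l : filt D l -> filt D (r *: l).
Proof.
by move=> [u hu]; exists (r *: u); rewrite linearZ -scalerBr; apply: pow_modZ.
Qed.

Lemma filtB D l l' : filt D l -> filt D l' -> filt D (l - l').
Proof. by move=> hl hl'; rewrite -scaleN1r; apply/filtD/filtZ. Qed.

Lemma filt_boundary D u : filt D (d1 u).
Proof. by exists u; rewrite subrr; apply: pow_mod_zero. Qed.

Lemma filt_sum D (I : Type) (s : seq I) (P : pred I) (F : I -> L0) :
  (forall j, P j -> filt D (F j)) -> filt D (\sum_(j <- s | P j) F j).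
Proof.
move=> h; apply: big_rec => [|j u Pj hu]; last exact: filtD (h j Pj) hu.
by rewrite -(raddf0 d1); apply: filt_boundary.
Qed.

Lemma filt_le D E l : (D <= E)%N -> filt E l -> filt D l.
Proof. by move=> DE [u hu]; exists u; apply: pow_mod_le hu. Qed.

(** Together with [filt_hsum_inv]: a form with coefficients in L0 lies one step
   deeper in the filtration exactly when its coefficients are 0 in k, that is,
   the associated graded module of N is a polynomial ring over k. *)
Lemma filt_hsum D c : (forall m, mdeg m = D -> eps (c m) = 0) ->
  filt D.+1 (hsum xv D c).
Proof.
move=> c0.
have h m : exists u, mdeg m = D -> gen_mod xv (c m - d1 u).
  have [md|mN] := eqVneq (mdeg m) D.
    2: by exists 0 => /eqP; rewrite (negPf mN).
  by have [u hu] := (eps_exact (c m)).1 (c0 m md); exists u.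
have [u hu] := choice h; exists (hsum xv D u).
rewrite hsum_linear -scaleN1r -hsumZ -hsumD; apply: pow_mod_hsum => m md.
by rewrite scaleN1r; apply: hu.
Qed.

(** If u is a form of degree j < d in x with coefficients p_m in L1, then d1 u
   is the form with coefficients d1 p_m; as it lies in (x)^(j+1) L0, every d1 p_m
   lies in (x) L0 by quasi-regularity, so p_m is a boundary d2 v_m modulo (x).
   Subtracting the boundary of the form with coefficients v_m raises j. *)
Lemma lift_boundary d u j : (j <= d)%N -> pow_mod xv d (d1 u) ->
  exists2 u', d1 u' = d1 u & pow_mod xv j u'.
Proof.
move=> jd du; elim: j jd => [|j IHj] jd.
  by exists u => //; apply: pow_mod0.
have [u' e' [p ep]] := IHj (ltnW jd).
have gp m : mdeg m = j -> gen_mod xv (d1 (p m)).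
  move: m; apply: (free_quasi_regular x_regular free0).
  by rewrite -hsum_linear -ep e'; apply: pow_mod_le du.
have h m : exists v, mdeg m = j -> gen_mod xv (p m - d2 v).
  have [md|mN] := eqVneq (mdeg m) j.
    2: by exists 0 => /eqP; rewrite (negPf mN).
  by have [v hv] := exact1 (gp m md); exists v.
have [v hv] := choice h; exists (u' - d2 (hsum xv j v)).
  by rewrite raddfB /= d12 subr0.
rewrite ep hsum_linear -scaleN1r -hsumZ -hsumD; apply: pow_mod_hsum => m md.
by rewrite scaleN1r; apply: hv.
Qed.

Lemma filt_hsum_inv d c : filt d.+1 (hsum xv d c) ->
  forall m, mdeg m = d -> eps (c m) = 0.
Proof.
move=> [u hu] m md.
have du : pow_mod xv d (d1 u).
  have -> : d1 u = hsum xv d c - (hsum xv d c - d1 u).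
    by rewrite opprB addrC subrK.
  by apply: pow_modB; [exists c | apply: pow_modS].
have [u' e' [p ep]] := lift_boundary (leqnn d) du.
apply/eps_exact; exists (p m); rewrite -scaleN1r.
apply: (free_quasi_regular x_regular free0
  (c := fun m => c m + -1 *: d1 (p m))) md.
by rewrite hsumD hsumZ -hsum_linear -ep e' scaleN1r.
Qed.

Lemma eps_sub_max r l : r \in aug_max R -> eps (r *: l) = 0.
Proof. by move=> rm; rewrite epsZ aug_res0 // mul0r. Qed.

(** The maximal ideal acts on N through (x), as N / (x) N = k: so convergence in
   R implies convergence in N for the powers of (x). *)
Lemma filt_max r D l : r \in aug_max R -> filt D l -> filt D.+1 (r *: l).
Proof.
move=> rm [u [c ec]].
have -> : r *: l = d1 (r *: u) + hsum xv D (fun m => r *: c m).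
  by rewrite hsumZ -ec scalerBr linearZ addrC subrK.
apply: filtD; last by apply: filt_hsum => m _; apply: eps_sub_max.
exact: filt_boundary.
Qed.

Lemma filt_max_pow D r l : r \in ideal_pow (aug_max R) D -> filt D (r *: l).
Proof.
move=> /asboolP[p [c [y [yI ->]]]]; rewrite scaler_suml; apply: filt_sum => i _.
rewrite -scalerA; apply: filtZ; move: (y i) (yI i) => z zI {p c y yI i}.
elim: D z zI => [|D IHD] z zI; first by exists 0; apply: pow_mod0.
rewrite big_ord_recl -scalerA; apply: filt_max => //.
exact: IHD.
Qed.

Lemma psumS_scale a N : psum x a N.+1 *: e =
  psum x a N *: e + hsum xv N (fun m => (a m)%:A *: e).
Proof.
rewrite psumS scalerDl; congr (_ + _); rewrite scaler_suml.
apply: eq_bigr => m _.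
by rewrite !scalerA -scalerAr mulr1.
Qed.

Lemma eps_scalar (c : k) : eps (c%:A *: e) = c.
Proof.
by rewrite epsZ eps_e mulr1 aug_res_scalar.
Qed.

(** The remainder at order N is a form of degree N with coefficients in L0;
   replacing these by the multiples of e with the same image in k gives the
   coefficients of degree N of a. *)
Lemma psum_ex l N : exists a, filt N (l - psum x a N *: e).
Proof.
elim: N => [|N [a [u [c ec]]]]; first by exists (fun=> 0), 0; apply: pow_mod0.
pose b m := if mdeg m == N then eps (c m) else a m; exists b.
rewrite psumS_scale (@eq_psum _ _ _ _ b a); last first.
  by move=> m mN; rewrite /b ltn_eqF.
rewrite opprD addrA -[l - _](subrK (d1 u)) ec addrAC addrC.
apply: filtD; first exact: filt_boundary.
rewrite -scaleN1r -hsumZ -hsumD; apply: filt_hsum => m md.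
by rewrite scaleN1r epsB eps_scalar /b md eqxx subrr.
Qed.

Lemma psum_uniq a N : filt N (psum x a N *: e) ->
  forall m, (mdeg m < N)%N -> a m = 0.
Proof.
elim: N => // N IHN h.
have a0 m : (mdeg m < N)%N -> a m = 0.
  apply: IHN.
  rewrite -[X in filt _ X](addrK (hsum xv N (fun m => (a m)%:A *: e))).
  rewrite -psumS_scale; apply: filtB; first exact: filt_le h.
  by exists 0; rewrite raddf0 subr0; eexists.
move: h; rewrite psumS_scale (@eq_psum _ _ _ _ a (fun=> 0)) //.
rewrite /psum big1 ?scale0r ?add0r => [|m _]; last by rewrite scale0r.
move=> /filt_hsum_inv h m; rewrite ltnS leq_eqVlt => /orP[/eqP md|].
  2: exact: a0.
by rewrite -(h m md) eps_scalar.
Qed.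

(** By uniqueness the expansions of r e at the various orders are truncations of
   one power series. *)
Lemma pser_limit r : exists2 f, f \in pser x & forall N, filt N ((r - f) *: e).
Proof.
have [a aP] := choice (psum_ex (r *: e)).
have compat N M m : (N <= M)%N -> (mdeg m < N)%N -> a M m = a N m.
  move=> NM mN; apply/eqP; rewrite -subr_eq0; apply/eqP.
  apply: (psum_uniq (N := N) (a := fun m => a M m - a N m)) mN.
  rewrite psumB scalerBl -(subrKA (psum x (a M) M *: e)).
  rewrite -[_ *: e - psum x (a N) N *: e](subrKA (r *: e)).
  have filtN l l' : filt N (l - l') -> filt N (l' - l).
    by move=> h; rewrite -opprB -scaleN1r; apply: filtZ.
  apply: filtD; last by apply: filtD => //; apply/filtN/(filt_le NM).
  by apply: filtN; rewrite -scalerBl; apply/filt_max_pow/psum_le.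
(* The expansion at any order N > mdeg m gives the same coefficient at m. *)
pose b m := a (mdeg m).+1 m.
have bE N : psum x b N = psum x (a N) N.
  by apply: eq_psum => m mN; rewrite /b -(compat _ N m).
have [f fP] : exists f, forall N, f - psum x b N \in ideal_pow (aug_max R) N.
  apply: R_complete.2 => N; rewrite -!peval_trunc; apply: peval_congr => m mN.
  by rewrite !mcoeff_trunc // ltnW.
exists f; first by apply/asboolP; exists b.
move=> N; have -> : (r - f) *: e =
    (r *: e - psum x (a N) N *: e) - (f - psum x b N) *: e.
  by rewrite -scalerBl -scalerBl -bE; congr (_ *: _); ring.
by apply: filtB => //; apply: filt_max_pow.
Qed.

Lemma pser_filt0 f : f \in pser x -> (forall N, filt N (f *: e)) -> f = 0.
Proof.
move=> /asboolP[a fa] h; apply: R_complete.1 => N.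
have : psum x a N = 0.
  rewrite /psum big1 // => m _; rewrite (@psum_uniq a N) ?scale0r ?bmdeg //.
  have -> : psum x a N *: e = f *: e - (f - psum x a N) *: e.
    by rewrite -scalerBl; congr (_ *: _); ring.
  by apply: filtB => //; apply: filt_max_pow.
by move=> p0; have := fa N; rewrite p0 subr0.
Qed.

Lemma lifted_retraction :
  exists g : {lrmorphism R -> pser_alg x}, is_retraction (pser_incl x) g.
Proof.
pose J r := forall N, filt N (r *: e).
have J_ideal a u v : J u -> J v -> J (a * u + v).
  by move=> hu hv N; rewrite scalerDl -scalerA; apply/filtD/hv/filtZ/hu.
have J_max u : J u -> u \in aug_max R.
  (* The case d = 0 of filt_hsum_inv: the form reduces to its constant term. *)
  move=> /(_ 1%N) h; have <- : u - (eps (u *: e))%:A = u; last first.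
    by rewrite epsZ eps_e mulr1 aug_resP.
  suff -> : eps (u *: e) = 0 by rewrite scale0r subr0.
  apply: (@filt_hsum_inv 0 (fun=> u *: e) _ 0%MM); last by rewrite mdeg0.
  by rewrite hsum0.
have J_inter f : f \in pser x -> J f -> f = 0 by apply: pser_filt0.
eexists; apply: (compl_retraction J_ideal J_max pser_limit J_inter).
Qed.

End Lifted.

Section LiftableRetraction.
Variables (k : fieldType) (R : augAlg k) (n : nat) (x : 'I_n -> maxid R).
Local Notation xv := (fun i => val (x i)).

Lemma seq_proj0 r : seq_proj x r = 0 <-> r \in ideal_gen xv.
Proof.
suff -> : (r \in ideal_gen xv) = (seq_proj x r == 0) by split=> /eqP.
by rewrite -(rmorph0 (seq_proj x)) -Quotient.idealrBE subr0.
Qed.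

Lemma gen_mod_phi0 (L : lmodType R) (F : lmodType (seq_quot x))
  (phi : {linear L -> F | seq_proj x \; *:%R}) v : gen_mod xv v -> phi v = 0.
Proof.
move=> [w ->]; rewrite raddf_sum big1 // => i _ /=; rewrite linearZ /=.
rewrite (_ : seq_proj x _ = 0) ?scale0r //.
exact/seq_proj0/(mem_ideal_gen (fun i => val (x i))).
Qed.

Lemma liftable_retraction : aug_complete R -> regular_seq xv ->
  liftable (seq_proj x) (res_mod x) ->
  exists g : {lrmorphism R -> pser_alg x}, is_retraction (pser_incl x) g.
Proof.
move=> Rc xreg [F [_ [_ Fex [aug [augS augK]]] [L [Lfree [phi [bc phid]]]]]].
have surj i w : exists v, w = phi i v.
  by apply: base_change_surj (bc i) w; apply: seq_proj_surj.
have ker i v : phi i v = 0 -> gen_mod xv v.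
  by apply: base_change_ker (Lfree i) (bc i) => r /seq_proj0.
have [e0 e0P] := augS (1 : k); have [e eE] := surj 0 e0.
pose eps l : k := aug (phi 0 l).
apply: (@lifted_retraction k R n x (L 0) (L (1 + 0)) (L (1 + (1 + 0)))
  (cx_d L 0) (cx_d L (1 + 0)) eps e) => //.
- exact: cx_dd.
- move=> u /(gen_mod_phi0 (phi 0)); rewrite phid => /(Fex 0%N)[w].
  have [v -> e1] := surj _ w.
  by exists v; apply: ker; rewrite raddfB /= phid e1 subrr.
- by move=> l l'; rewrite /eps !raddfB.
- move=> r l; rewrite /eps linearZ /= linearZ /=.
  by rewrite -[_ *: _]/(quot_res _ * _) quot_res_proj.
- by rewrite /eps -eE.
move=> l; split=> [/augK[w ew]|[u /(gen_mod_phi0 (phi 0))]].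
  have [u eu] := surj _ w; exists u; apply: ker.
  by rewrite raddfB /= phid -eu -ew subrr.
rewrite raddfB /= phid => /eqP; rewrite subr_eq0 => /eqP e1.
by apply/augK; eexists; exact: e1.
Qed.

End LiftableRetraction.

(** * Free resolutions over noetherian rings *)

Section NoetherianKernels.
Variable A : comNzRingType.
Hypothesis A_noeth : noetherian A.

Definition noetherian_rank p := forall U : 'rV[A]_p -> Prop,
  U 0 -> (forall a u v, U u -> U v -> U (a *: u + v)) ->
  exists q (B : 'M[A]_(q, p)), forall v, U v <-> exists w, v = w *m B.

(** The first entries of the rows of U form an ideal; lifts to U of its
   generators, together with generators of the rows of U with first entry 0,
   generate U. *)
Lemma noetherian_rowS p : noetherian_rank p -> noetherian_rank (1 + p).
Proof.
move=> IHp U U0 Ulin.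
pose I : {pred A} := [pred r | `[< exists v : 'rV_p, U (row_mx r%:M v) >]].
have Iid : is_ideal I.
  split; first by apply/asboolP; exists 0; rewrite raddf0 row_mx0.
  move=> a r s /asboolP[u hu] /asboolP[v hv]; apply/asboolP.
  exists (a *: u + v); have := Ulin a _ _ hu hv.
  by rewrite scale_row_mx add_row_mx scale_scalar_mx -raddfD.
have [s [g gI]] := A_noeth Iid.
have [||q [B BP]] := IHp (fun v => U (row_mx 0 v)).
- by rewrite row_mx0.
- move=> a u v hu hv; have := Ulin a _ _ hu hv.
  by rewrite scale_row_mx add_row_mx scaler0 addr0.
have gP i : exists v : 'rV_p, U (row_mx (g i)%:M v).
  by apply/asboolP; change (g i \in I); rewrite gI mem_ideal_gen.
have [v vP] := choice gP.
pose G : 'M[A]_(s, 1 + p) := \matrix_i row_mx (g i)%:M (v i).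
have UG (c : 'rV_s) : U (c *m G).
  rewrite mulmx_sum_row; elim/big_rec: _ => // i y _ Uy.
  by apply: Ulin => //; rewrite rowK.
exists (s + q)%N, (col_mx G (row_mx 0 B)) => u; split=> [Uu|[w ->]]; last first.
  rewrite -[w]hsubmxK mul_row_col -[X in U (X + _)]scale1r; apply: Ulin => //.
  by rewrite mul_mx_row mulmx0; apply/BP; exists (rsubmx w).
have /asboolP[c ec] : lsubmx u 0 0 \in ideal_gen g.
  rewrite -gI; apply/asboolP; exists (rsubmx u).
  by rewrite -mx11_scalar hsubmxK.
pose d : 'rV_s := \row_i c i.
have eG : lsubmx (d *m G) = lsubmx u.
  rewrite [RHS]mx11_scalar ec [LHS]mx11_scalar; congr _%:M.
  rewrite !mxE; apply: eq_bigr => i _.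
  by rewrite !mxE -[lshift p 0]/(unsplit (inl 0)) unsplitK mxE eqxx mulr1n.
have [w ew] : exists w, rsubmx (u - d *m G) = w *m B.
  apply/BP; have := Ulin (-1) _ _ (UG d) Uu.
  rewrite scaleN1r addrC -[X in U X -> _]hsubmxK.
  by rewrite raddfB /= eG subrr.
exists (row_mx d w); rewrite mul_row_col mul_mx_row mulmx0 -ew.
rewrite -[LHS](subrK (d *m G)) addrC; congr (_ + _).
by rewrite -[LHS]hsubmxK raddfB /= eG subrr.
Qed.

Lemma noetherian_row p : noetherian_rank p.
Proof.
elim: p => [|p /noetherian_rowS //] U U0 Ulin.
exists 0%N, 0 => v; rewrite (thinmx0 v).
by split=> // _; exists 0; rewrite mul0mx.
Qed.

Lemma noetherian_ker p q (M : 'M[A]_(p, q)) :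
  exists r (B : 'M[A]_(r, p)),
    forall v : 'rV_p, v *m M = 0 <-> exists w, v = w *m B.
Proof.
apply: (noetherian_row (U := fun v => v *m M = 0)) => [|a u v hu hv].
  by rewrite mul0mx.
by rewrite mulmxDl -scalemxAl hu hv scaler0 addr0.
Qed.

(** A matrix with its dimensions, so that taking syzygies can be iterated; the
   number of columns of a syzygy matrix is convertible to the number of rows of
   the matrix before it. *)
Record some_matrix := SomeMatrix {
  sm_rows : nat; sm_cols : nat; sm_mx : 'M[A]_(sm_rows, sm_cols) }.

Fact syzygy_ex (M : some_matrix) : {r & {B : 'M[A]_(r, sm_rows M) |
  forall v : 'rV_(sm_rows M), v *m sm_mx M = 0 <-> exists w, v = w *m B}}.
Proof. by have [r /cid h] := cid (noetherian_ker (sm_mx M)); exists r. Qed.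

Definition syzygy (M : some_matrix) := SomeMatrix (sval (projT2 (syzygy_ex M))).

Lemma noetherian_resolution (U : A -> Prop) :
  U 0 -> (forall a u v, U u -> U v -> U (a * u + v)) ->
  exists (r : nat -> nat) (D0 : 'M[A]_(r 0, 1))
    (D : forall i, 'M[A]_(r i.+1, r i)),
  [/\ forall a, U a <-> exists w, a%:M = w *m D0 :> 'M_1,
      forall v : 'rV_(r 0), v *m D0 = 0 <-> exists w, v = w *m D 0%N
    & forall i (v : 'rV_(r i.+1)), v *m D i = 0 <-> exists w, v = w *m D i.+1].
Proof.
move=> U0 Ulin; have [||q [B BP]] := @noetherian_row 1 (fun v => U (v 0 0)).
- by rewrite mxE.
- by move=> a u v hu hv; rewrite !mxE; apply: Ulin.
pose M i := iter i syzygy (SomeMatrix B).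
exists (fun i => sm_rows (M i)), B, (fun i => sm_mx (M i.+1)); split.
- by move=> a; rewrite -BP mxE eqxx mulr1n.
- exact: (svalP (projT2 (syzygy_ex (SomeMatrix B)))).
by move=> i; exact: (svalP (projT2 (syzygy_ex (M i.+1)))).
Qed.

End NoetherianKernels.

(** * Complexes of row vectors *)

Section MatrixComplex.
Variables (Q : comNzRingType) (rk : nat -> nat).
Variable D : forall i, 'M[Q]_(rk i.+1, rk i).
Hypothesis DD : forall i, D i.+1 *m D i = 0.

Definition mxcx_mod (i : int) : lmodType Q :=
  match i with Posz p => 'rV[Q]_(rk p) | Negz _ => 'rV[Q]_0 end.

(** The two types in the positive case agree because 1 + Posz p is convertible
   to Posz p.+1. *)
Definition mxcx_d (i : int) : {linear mxcx_mod (1 + i) -> mxcx_mod i} :=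
  match i return {linear mxcx_mod (1 + i) -> mxcx_mod i} with
  | Posz p => mulmxr (D p)
  | Negz p => \0
  end.

Fact mxcx_dd (i : int) v : mxcx_d i (mxcx_d (1 + i) v) = 0.
Proof. by case: i v => [p|p] v //=; rewrite -mulmxA DD mulmx0. Qed.

Definition mxcx : complex Q := Complex mxcx_dd.

Lemma row_free_module p : is_free 'rV[Q]_p.
Proof.
exists (fun v => exists i, v = delta_mx 0 i); split=> [v|s c us sB e b bs].
  (* The coefficient of a basis vector b is its scalar product with v. *)
  exists (map (delta_mx 0) (enum 'I_p)),
    (fun b : 'rV_p => \sum_i b 0 i * v 0 i).
  split; first by move=> b /mapP[i _ ->]; exists i.
  rewrite big_map [LHS]row_sum_delta big_enum; apply: eq_bigr => i _ /=.
  congr (_ *: _); rewrite (bigD1 i) //= mxE !eqxx mul1r big1 ?addr0 //.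
  by move=> j /negPf ji; rewrite mxE ji andbF mul0r.
have [i bi] := sB b bs.
have := congr1 (fun v : 'rV_p => v 0 i) e; rewrite mxE summxE.
rewrite (bigD1_seq b) //= mxE {2}bi mxE !eqxx mulr1 big_seq_cond.
rewrite big1 ?addr0 // => b' /andP[/sB[j ej] ji]; rewrite mxE ej mxE eqxx /=.
by case: eqP => [ij|_]; rewrite ?mulr0 //; rewrite ej -ij -bi eqxx in ji.
Qed.

Lemma mxcx_free : free_complex mxcx.
Proof. by case=> p; apply: row_free_module. Qed.

End MatrixComplex.

Section RowBaseChange.
Variables (R Rbar : comNzRingType) (pi : {rmorphism R -> Rbar}).

Definition row_map p (v : 'rV[R]_p) : 'rV[Rbar]_p := map_mx pi v.
Fact row_map_linear p : linear_for (pi \; *:%R) (@row_map p).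
Proof. by move=> a u v; rewrite /row_map map_mxD map_mxZ. Qed.
HB.instance Definition _ p := GRing.isLinear.Build R 'rV[R]_p 'rV[Rbar]_p
  (pi \; *:%R) (@row_map p) (@row_map_linear p).

Definition row_ext p (P : lmodType Rbar) (h : 'rV[R]_p -> P)
    (w : 'rV[Rbar]_p) : P :=
  \sum_j w 0 j *: h (delta_mx 0 j).
Fact row_ext_linear p (P : lmodType Rbar) (h : 'rV[R]_p -> P) :
  linear (row_ext h).
Proof.
move=> a u v; rewrite /row_ext scaler_sumr -big_split /=; apply: eq_bigr => j _.
by rewrite !mxE scalerDl scalerA.
Qed.
HB.instance Definition _ p (P : lmodType Rbar) (h : 'rV[R]_p -> P) :=
  GRing.isLinear.Build Rbar 'rV[Rbar]_p P *:%R (row_ext h) (row_ext_linear h).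

Lemma row_base_change p :
  base_change (@row_map p : {linear _ -> _ | pi \; *:%R}).
Proof.
move=> P h; exists (row_ext h); split=> [v|g gh w].
  rewrite [in RHS](row_sum_delta v) raddf_sum; apply: eq_bigr => j _ /=.
  by rewrite linearZ mxE.
rewrite [in LHS](row_sum_delta w) raddf_sum; apply: eq_bigr => j _ /=.
by rewrite linearZ -gh /= /row_map map_delta_mx.
Qed.

Variables (rk : nat -> nat) (D : forall i, 'M[R]_(rk i.+1, rk i)).
Hypothesis DD : forall i, D i.+1 *m D i = 0.

Fact map_DD i : map_mx pi (D i.+1) *m map_mx pi (D i) = 0.
Proof. by rewrite -map_mxM DD map_mx0. Qed.

Definition mxcx_map (i : int) :
    {linear mxcx DD i -> mxcx map_DD i | pi \; *:%R} :=
  match i return {linear mxcx DD i -> mxcx map_DD i | pi \; *:%R} with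
  | Posz p => @row_map (rk p)
  | Negz _ => @row_map 0
  end.

Lemma mxcx_liftable : liftable_complex pi (mxcx map_DD).
Proof.
exists (mxcx DD); split; first exact: mxcx_free.
exists mxcx_map; split=> [[]p|[]p v]; try exact: row_base_change.
  by rewrite /= /row_map map_mxM.
by rewrite /= raddf0.
Qed.

End RowBaseChange.

(** * Retractions give liftings of the residue field *)

Lemma exact_mulmx0 (A : comNzRingType) p q s (M : 'M[A]_(p, q))
    (M' : 'M[A]_(s, p)) :
  (forall v : 'rV_p, v *m M = 0 <-> exists w, v = w *m M') -> M' *m M = 0.
Proof.
move=> ex; apply/row_matrixP => i; rewrite row_mul row0; apply/ex.
by exists (delta_mx 0 i); rewrite rowE.
Qed.

Section ExactModulo.
Variables (R : comNzRingType) (n : nat) (x : 'I_n -> R) (J : R -> Prop).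
Hypothesis x_regular : regular_seq x.
Hypothesis J_regular : forall (j : 'I_n) a b,
  J b -> x j * a - b \in ideal_init x j ->
  exists2 b', J b' & a - b' \in ideal_init x j.

Variables (r : nat -> nat) (D0 : 'M[R]_(r 0, 1)).
Variable D : forall i, 'M[R]_(r i.+1, r i).
Hypothesis D0_J : forall a, J a <-> exists w, a%:M = w *m D0 :> 'M_1.
Hypothesis D0_exact : forall v : 'rV_(r 0),
  v *m D0 = 0 <-> exists w, v = w *m D 0.
Hypothesis D_exact : forall i (v : 'rV_(r i.+1)),
  v *m D i = 0 <-> exists w, v = w *m D i.+1.

Definition in_init j p (v : 'rV[R]_p) := forall l, v 0 l \in ideal_init x j.

Lemma in_initZD j p a (u v : 'rV[R]_p) :
  in_init j u -> in_init j v -> in_init j (a *: u + v).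
Proof. by move=> hu hv l; rewrite !mxE ideal_initMD. Qed.

Lemma in_initM j p q (M : 'M[R]_(p, q)) v : in_init j v -> in_init j (v *m M).
Proof.
move=> hv l; rewrite !mxE; apply: ideal_init_sum => i _.
by rewrite mulrC ideal_initM.
Qed.

Lemma in_initS (j : 'I_n) p (v : 'rV[R]_p) : in_init j.+1 v ->
  exists u, in_init j (v - x j *: u).
Proof.
move=> hv; have [f fP] := choice (fun l => ideal_initS (hv l)).
by exists (\row_l f l) => l; rewrite !mxE mulrC.
Qed.

Lemma in_init0 p (v : 'rV[R]_p) : in_init 0 v -> v = 0.
Proof.
move=> hv; apply/rowP => l; have /asboolP[c ->] := hv l.
by rewrite mxE big_pred0.
Qed.

Definition exact_at j p q s (M : 'M[R]_(p, q)) (M' : 'M[R]_(s, p)) :=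
  forall v, in_init j (v *m M) -> exists w, in_init j (v - w *m M').

(** If v M = x_j u + t with t in (x_0, ..., x_(j-1)), and u = w M modulo that
   ideal, then v - x_j w is a cycle modulo that ideal, hence a boundary
   there. *)
Lemma exact_atS (j : 'I_n) p q s (M : 'M[R]_(p, q)) (M' : 'M[R]_(s, p)) :
  M' *m M = 0 ->
  (forall u t v, v *m M = x j *: u + t -> in_init j t ->
     exists w, in_init j (u - w *m M)) ->
  exact_at j M M' -> exact_at j.+1 M M'.
Proof.
move=> MM lift ex v /in_initS[u hu].
have [w hw] := lift u (v *m M - x j *: u) v (esym (subrKC _ _)) hu.
have [|w' hw'] := ex (v - x j *: w).
  have -> : (v - x j *: w) *m M = x j *: (u - w *m M) + (v *m M - x j *: u).
    by rewrite mulmxBl -scalemxAl scalerBr [RHS]addrC addrA subrK.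
  exact: in_initZD.
exists w' => l; have := hw' l; rewrite !mxE => h.
rewrite -[v 0 l](subrK (x j * w 0 l)) addrAC ideal_initD //.
  by apply: ideal_init_le h; apply: leqnSn.
by rewrite mulrC ideal_initM // ideal_initX.
Qed.

(** Regularity of x on the previous term of the resolution, or on R / J for the
   first one, provides the hypothesis of [exact_atS]. *)
Lemma exact_modulo j : (j <= n)%N ->
  exact_at j D0 (D 0) /\ forall i, exact_at j (D i) (D i.+1).
Proof.
elim: j => [_|j IHj jn].
  split=> [|i] v /in_init0; [move=> /D0_exact[w ->]|move=> /D_exact[w ->]];
    by exists w; rewrite subrr => l; rewrite mxE ideal_init0.
have [ex0 exS] := IHj (ltnW jn); pose jj := Ordinal jn.
have reg p (u : 'rV[R]_p) : in_init j (x jj *: u) -> in_init j u.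
  by move=> hu l; apply: (x_regular.1 jj); have := hu l; rewrite !mxE.
have D1 : D 0 *m D0 = 0 := exact_mulmx0 D0_exact.
have DS i : D i.+1 *m D i = 0 := exact_mulmx0 (@D_exact i).
have lift p q s (M : 'M[R]_(p, q)) (M' : 'M[R]_(s, p)) : M' *m M = 0 ->
    exact_at j M M' -> forall (u t : 'rV_p) (v : 'rV_s),
    v *m M' = x jj *: u + t -> in_init j t -> exists w, in_init j (u - w *m M').
  move=> MM ex u t v e ht; apply: ex; apply: reg.
  have -> : x jj *: (u *m M) = - (t *m M).
    by apply/eqP; rewrite -addr_eq0 scalemxAl -mulmxDl -e -mulmxA MM mulmx0.
  by rewrite -mulNmx; apply: in_initM => l; rewrite mxE -mulN1r ideal_initM.
split=> [|i]; last first.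
  apply: (exact_atS (j := jj)) (DS i) _ (exS i).
  by case: i => [|i]; [apply: lift D1 ex0 | apply: lift (DS i) (exS i)].
apply: (exact_atS (j := jj)) D1 _ ex0 => u t v e ht.
have [||b /D0_J[w ew] hb] :=
  J_regular (j := jj) (a := u 0 0) (b := (v *m D0) 0 0).
- by apply/D0_J; exists v; rewrite -mx11_scalar.
- by rewrite e !mxE opprD addrA subrr sub0r -mulN1r ideal_initM.
exists w => l; rewrite ord1 -ew !mxE eqxx mulr1n; exact: hb.
Qed.

End ExactModulo.

Lemma aug_hom_res (k : fieldType) (A B : augAlg k) (f : {lrmorphism A -> B}) r :
  aug_hom f -> aug_res (f r) = aug_res r.
Proof.
move=> fm; apply: aug_res_uniq.
by have := fm _ (aug_resP r); rewrite rmorphB /= linearZ /= rmorph1.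
Qed.

Section RetractionLiftable.
Variables (k : fieldType) (R : augAlg k) (n : nat) (x : 'I_n -> maxid R).
Local Notation xv := (fun i => val (x i)).

Definition res_form (w : 'rV[seq_quot x]_1) : res_mod x := quot_res (w 0 0).
Fact res_form_linear : linear res_form.
Proof. by move=> q u v; rewrite /res_form !mxE rmorphD rmorphM. Qed.
HB.instance Definition _ := GRing.isLinear.Build (seq_quot x) 'rV[seq_quot x]_1
  (res_mod x) *:%R res_form res_form_linear.

Lemma retraction_liftable (g : {lrmorphism R -> pser_alg x}) :
  noetherian R -> aug_complete R -> regular_seq xv ->
  is_retraction (pser_incl x) g -> liftable (seq_proj x) (res_mod x).
Proof.
move=> Rn Rc xreg [_ gm _ _ gK]; pose J r := g r = 0.
have [||r [D0 [D [D0J D0ex Dex]]]] := noetherian_resolution Rn (U := J).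
- exact: raddf0.
- by move=> a u v gu gv; rewrite /J rmorphD rmorphM /= gu gv mulr0 addr0.
have Jproj a : J (a - sub_incl (g a)) by rewrite /J rmorphB /= gK subrr.
have gx (i : 'I_n) : sub_incl (g (val (x i))) = val (x i).
  by rewrite -[val (x i)]/(pser_incl x (pser_var x i)) gK.
(* Apply g to the relation, then use regularity in R: the power series g a is
   itself a combination of the x l with l < j. *)
have Jreg (j : 'I_n) a b : J b -> val (x j) * a - b \in ideal_init xv j ->
  exists2 b', J b' & a - b' \in ideal_init xv j.
  move=> Jb /asboolP[c ec]; exists (a - sub_incl (g a)); first exact: Jproj.
  rewrite opprB addrC subrK; apply: xreg.1; apply/asboolP.
  exists (fun l => sub_incl (g (c l))).
  have := congr1 (fun r => sub_incl (g r)) ec.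
  rewrite !rmorphB !rmorphM /= Jb rmorph0 subr0 gx => ->.
  by rewrite !rmorph_sum; apply: eq_bigr => l _; rewrite !rmorphM /= gx.
have [ex0 exS] := exact_modulo xreg Jreg D0J D0ex Dex (leqnn n).
pose rk i := if i is j.+1 then r j else 1%N.
pose DD i : 'M[R]_(rk i.+1, rk i) :=
  match i return 'M[R]_(rk i.+1, rk i) with 0%N => D0 | j.+1 => D j end.
have DDD i : DD i.+1 *m DD i = 0.
  by case: i => [|i]; apply: exact_mulmx0; [exact: D0ex|exact: Dex].
have exDD i v : in_init xv n (v *m DD i) ->
    exists w, in_init xv n (v - w *m DD i.+1).
  by case: i v => [|i] v; [apply: ex0 | apply: exS].
pose pi := seq_proj x.
have in_initP p (v : 'rV[R]_p) : in_init xv n v <-> map_mx pi v = 0.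
  split=> [hv|/rowP e l].
    by apply/rowP => l; rewrite !mxE; apply/seq_proj0; rewrite -ideal_init_gen.
  by rewrite ideal_init_gen; apply/seq_proj0; have := e l; rewrite !mxE.
have lift_row p (v : 'rV[seq_quot x]_p) : exists u : 'rV[R]_p, v = map_mx pi u.
  have [f fP] := choice (fun l => seq_proj_surj (v 0 l)).
  by exists (\row_l f l); apply/rowP => l; rewrite !mxE.
exists (mxcx (map_DD (seq_proj x) DDD)); split.
- exact: mxcx_free.
- split=> [p v|p v|]; first exact: thinmx0.
    have [u ->] := lift_row _ v.
    rewrite /= -map_mxM => /in_initP /exDD[w /in_initP].
    rewrite map_mxB map_mxM => /eqP; rewrite subr_eq0 => /eqP ->.
    by exists (map_mx pi w).
  exists res_form; split=> [u|v].
    exists (seq_proj x (u : k)%:A)%:M.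
    by rewrite /= /res_form mxE eqxx mulr1n quot_res_proj aug_res_scalar.
  have [u ->] := lift_row _ v; rewrite /= /res_form mxE quot_res_proj.
  split=> [u0|[w]].
    (* u = (u - g u) + g u, with g u in the maximal ideal (x) of k[[x]]. *)
    have : g (u 0 0) \in aug_max (pser_alg x).
      by apply: gm; have := aug_resP (u 0 0); rewrite u0 scale0r subr0.
    rewrite (pser_max Rc) => /asboolP[c ec].
    have /D0J[w ew] := Jproj (u 0 0).
    exists (map_mx pi w); rewrite -map_mxM -ew [u in LHS]mx11_scalar.
    rewrite -[u 0 0 in LHS](subrK (sub_incl (g (u 0 0)))) raddfD map_mxD.
    rewrite [X in _ + X](_ : _ = 0) ?addr0 //; apply/in_initP => l.
    rewrite ord1 mxE eqxx mulr1n ideal_init_gen; apply/asboolP.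
    exists (fun i => sub_incl (c i)); rewrite ec rmorph_sum.
    by apply: eq_bigr => i _; rewrite rmorphM.
  have [w' ->] := lift_row _ w; rewrite -map_mxM => /eqP.
  rewrite -subr_eq0 -map_mxB => /eqP/in_initP/(_ 0); rewrite ideal_init_gen.
  have : J ((w' *m D0) 0 0) by apply/D0J; exists w'; rewrite -mx11_scalar.
  rewrite [(u - _) 0 0]mxE [(- (w' *m D0)) 0 0]mxE.
  move: ((w' *m D0) 0 0) => b Jb.
  move=> /(seq_ideal_max (x := x))/aug_res0/eqP.
  by rewrite rmorphB /= subr_eq0 -(aug_hom_res b gm) Jb rmorph0 => /eqP.
exact: mxcx_liftable.
Qed.

End RetractionLiftable.

(** * Retractions and semi-fiber product decompositions *)

Section KernelSubalgebra.
Variables (k : fieldType) (R : augAlg k) (n : nat) (x : 'I_n -> maxid R).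
Variable g : {lrmorphism R -> pser_alg x}.
Hypothesis g_retr : is_retraction (pser_incl x) g.

(** The subalgebra k + ker g. *)
Definition ker_sub : {pred R} :=
  [pred r | `[< exists c : k, g (r - c%:A) = 0 >]].

Fact ker_sub_closed : GRing.subalg_closed ker_sub.
Proof.
split.
- by apply/asboolP; exists 1; rewrite scale1r subrr raddf0.
- move=> a r s /asboolP[c hc] /asboolP[d hd]; apply/asboolP; exists (a * c + d).
  have -> : a *: r + s - (a * c + d)%:A = a *: (r - c%:A) + (s - d%:A).
    by rewrite scalerBr scalerA scalerDl opprD addrACA.
  by rewrite linearP /= hc hd scaler0 addr0.
move=> r s /asboolP[c hc] /asboolP[d hd]; apply/asboolP; exists (c * d).
have -> : r * s - (c * d)%:A = r * (s - d%:A) + d%:A * (r - c%:A).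
  have -> : (c * d)%:A = c%:A * d%:A :> R by rewrite -scalerAl mul1r scalerA.
  by ring.
by rewrite rmorphD !rmorphM /= hc hd !mulr0 addr0.
Qed.
HB.instance Definition _ := GRing.isSubalgClosed.Build k R ker_sub
  ker_sub_closed.

Definition ker_subalg : subalgClosed R := ker_sub.

(** A retraction preserves residues, so its kernel has residue 0. *)
Lemma ker_res r : g r = 0 -> r \in aug_max R.
Proof.
case: g_retr => _ gm _ _ _ gr.
have := aug_hom_res r gm; rewrite gr rmorph0 => r0.
by have := aug_resP r; rewrite -r0 scale0r subr0.
Qed.

Lemma ker_in r : g r = 0 -> r \in ker_subalg.
Proof. by move=> gr; apply/asboolP; exists 0; rewrite scale0r subr0. Qed.

Lemma ker_sub_max (s : sub_aug ker_subalg) :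
  s \in aug_max (sub_aug ker_subalg) <-> g (sub_incl s) = 0.
Proof.
split=> [|/ker_res//]; rewrite in_sub_max => sm.
have /asboolP[c hc] : sub_incl s \in ker_subalg by apply: valP.
have := aug_res_uniq (ker_res hc); rewrite aug_res0 // => c0.
by move: hc; rewrite -c0 scale0r subr0.
Qed.

Definition to_ker (r : R) (gr : g r = 0) : maxid (sub_aug ker_subalg) :=
  let s : sub_aug ker_subalg := exist _ r (ker_in gr) in
  exist (fun s => s \in aug_max (sub_aug ker_subalg)) s ((ker_sub_max s).2 gr).

Fact to_kerE r (gr : g r = 0) : sub_incl (val (to_ker gr)) = r.
Proof. by []. Qed.

Lemma ker_maxid (y : maxid (sub_aug ker_subalg)) : g (sub_incl (val y)) = 0.
Proof. by apply/ker_sub_max; apply: (valP y). Qed.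

Fact ker_act_in (t : pser_alg x) (y : maxid (sub_aug ker_subalg)) :
  g (sub_incl t * sub_incl (val y)) = 0.
Proof. by rewrite rmorphM /= ker_maxid mulr0. Qed.

Definition ker_act_fun (t : pser_alg x) (y : maxid (sub_aug ker_subalg)) :=
  to_ker (ker_act_in t y).

Lemma maxid_inj (S : subalgClosed R) (y z : maxid (sub_aug S)) :
  sub_incl (val y) = sub_incl (val z) -> y = z.
Proof. by move=> e; do 2!apply: val_inj. Qed.

Fact ker_actE t y :
  sub_incl (val (ker_act_fun t y)) = sub_incl t * sub_incl (val y).
Proof. by []. Qed.

Definition ker_act : sf_action (sub_aug (pser x)) (sub_aug ker_subalg).
Proof.
apply: (@SfAction _ _ _ ker_act_fun).
- move=> t t' y; apply: maxid_inj.
  by rewrite val_maxidD rmorphD !ker_actE rmorphD mulrDl.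
- move=> t y y'; apply: maxid_inj.
  by rewrite val_maxidD rmorphD !ker_actE val_maxidD rmorphD mulrDr.
- by move=> t t' y; apply: maxid_inj; rewrite !ker_actE rmorphM mulrA.
- move=> c y; apply: maxid_inj.
  by rewrite ker_actE val_maxidZ !linearZ /= rmorph1 mulr_algl.
- move=> t y s; apply: maxid_inj.
  by rewrite ker_actE !val_maxid_mul !rmorphM /= ker_actE mulrA.
Defined.

Definition ker_sum (u : sf_prod ker_act) : R :=
  sub_incl u.1 + sub_incl (val u.2).

Fact ker_sum_zmod : zmod_morphism ker_sum.
Proof. by move=> u v; rewrite /ker_sum !raddfB /= opprD addrACA. Qed.
Fact ker_sum_monoid : monoid_morphism ker_sum.
Proof.
split=> [|[t y] [t' y']]; first by rewrite /ker_sum rmorph1 rmorph0 addr0.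
by rewrite /ker_sum /= /sub_incl /=; ring.
Qed.
Fact ker_sum_scale : scalable ker_sum.
Proof. by move=> c u; rewrite /ker_sum scalerDr. Qed.
HB.instance Definition _ := GRing.isZmodMorphism.Build (sf_prod ker_act) R
  ker_sum ker_sum_zmod.
HB.instance Definition _ := GRing.isMonoidMorphism.Build (sf_prod ker_act) R
  ker_sum ker_sum_monoid.
HB.instance Definition _ := GRing.isScalable.Build k (sf_prod ker_act) R
  *:%R ker_sum ker_sum_scale.

(** The inverse of the sum maps r to its components g r and r - g r. *)
Lemma retraction_decomposition : sf_decomposition (pser x) ker_subalg.
Proof.
have [_ gm _ _ gK] := g_retr.
have gsum u : g (ker_sum u) = u.1 by rewrite rmorphD /= gK ker_maxid addr0.
exists ker_act, ker_sum; split=> //; split.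
  have proj r : g (r - sub_incl (g r)) = 0 by rewrite rmorphB /= gK subrr.
  exists (fun r => (g r, to_ker (proj r)) : sf_prod ker_act) => [[t y]|r].
    have e := gsum (t, y); congr (_, _); first exact: e.
    by apply: maxid_inj; rewrite to_kerE e /ker_sum /= addrC addKr.
  by rewrite -[LHS]/(sub_incl (g r) + (r - sub_incl (g r))) addrC subrK.
move=> u; rewrite rpredDr; last by apply/ker_res/ker_maxid.
by [].
Qed.

Lemma retraction_split : split_by_kernel g ker_subalg.
Proof.
split=> r; split.
- move=> /asboolP[c hc]; exists c, (r - c%:A); split=> //.
  by rewrite [RHS]addrC subrK.
- move=> [c [y [gy ->]]]; apply/asboolP; exists c.
  by rewrite addrC addKr.
- by move=> gr; exists (exist _ r (ker_in gr)) => //; apply/ker_sub_max.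
by move=> [s /ker_sub_max gs ->].
Qed.

End KernelSubalgebra.

Section Decomposition.
Variables (k : fieldType) (R : augAlg k) (n : nat) (x : 'I_n -> maxid R).
Variables (S : subalgClosed R).
Variable a : sf_action (sub_aug (pser x)) (sub_aug S).
Variable phi : {lrmorphism sf_prod a -> R}.
Variable psi : R -> sf_prod a.
Hypotheses (phiK : cancel phi psi) (psiK : cancel psi phi).
Hypothesis phi_max :
  forall u, (phi u \in aug_max R) = (u \in aug_max (sf_prod a)).
Hypothesis phiE : forall t y, phi (t, y) = sub_incl t + sub_incl (val y).

Definition sf_fst (r : R) : pser_alg x := (psi r).1.

Fact sf_fst_zmod : zmod_morphism sf_fst.
Proof. by move=> r s; rewrite /sf_fst (can2_zmod_morphism phiK psiK). Qed.
Fact sf_fst_monoid : monoid_morphism sf_fst.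
Proof.
have [psi1 psiM] := can2_monoid_morphism phiK psiK.
by split=> [|r s]; rewrite /sf_fst ?psi1 ?psiM.
Qed.
Fact sf_fst_scale : scalable sf_fst.
Proof. by move=> c r; rewrite /sf_fst (can2_scalable phiK psiK). Qed.
HB.instance Definition _ := GRing.isZmodMorphism.Build R (pser_alg x)
  sf_fst sf_fst_zmod.
HB.instance Definition _ := GRing.isMonoidMorphism.Build R (pser_alg x)
  sf_fst sf_fst_monoid.
HB.instance Definition _ := GRing.isScalable.Build k R (pser_alg x) *:%R
  sf_fst sf_fst_scale.

Lemma sf_fst_sum t (y : maxid (sub_aug S)) :
  sf_fst (sub_incl t + sub_incl (val y)) = t.
Proof. by rewrite -phiE /sf_fst phiK. Qed.

Lemma decomposition_retraction : exists2 g : {lrmorphism R -> pser_alg x},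
  is_retraction (pser_incl x) g & split_by_kernel g S.
Proof.
have decomp r : exists y : maxid (sub_aug S),
    r = sub_incl (sf_fst r) + sub_incl (val y).
  by exists (psi r).2; rewrite -phiE -surjective_pairing psiK.
have K : cancel (pser_incl x) sf_fst.
  by move=> t; rewrite -{2}(sf_fst_sum t 0) raddf0 addr0.
have fst0 (y : maxid (sub_aug S)) : sf_fst (sub_incl (val y)) = 0.
  by rewrite -(sf_fst_sum 0 y) raddf0 add0r.
exists sf_fst; split.
- by [].
- by move=> r rm; have := phi_max (psi r); rewrite psiK rm inE.
- exact: can_inj K.
- by move=> t; exists (sub_incl t); exact: K.
- exact: K.
- move=> r; split=> [rS|[c [y [gy ->]]]].
    pose s : sub_aug S := exist _ r rS; have sm := aug_resP s.
    pose y : maxid (sub_aug S) :=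
      exist (fun z => z \in aug_max (sub_aug S)) _ sm.
    exists (aug_res s), (sub_incl (val y)); split; first exact: fst0.
    have -> : sub_incl (val y) = r - (aug_res s)%:A by [].
    by rewrite [RHS]addrC subrK.
  have [y' ey] := decomp y; rewrite ey gy raddf0 add0r rpredD ?rpredZ ?rpred1 //.
  exact: (valP (val y')).
move=> r; split=> [gr|[s sm ->]].
  2: exact: (fst0 (exist (fun z => z \in aug_max (sub_aug S)) s sm)).
have [y ->] := decomp r; rewrite gr raddf0 add0r.
by exists (val y) => //; apply: (valP y).
Qed.

End Decomposition.

Theorem corollary4p4 (k : fieldType) (R : augAlg k) (n : nat)
    (x : 'I_n -> maxid R)
    (R_noetherian : noetherian R) (R_local : aug_local R)
    (R_complete : aug_complete R)
    (x_regular : regular_seq (fun i => val (x i))) :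
  [/\ liftable (seq_proj x) (res_mod x) <->
        exists g : {lrmorphism R -> pser_alg x}, is_retraction (pser_incl x) g,
      (exists g : {lrmorphism R -> pser_alg x}, is_retraction (pser_incl x) g)
        <-> exists S : subalgClosed R, sf_decomposition (pser x) S,
      forall S : subalgClosed R, sf_decomposition (pser x) S ->
        exists2 g : {lrmorphism R -> pser_alg x},
          is_retraction (pser_incl x) g & split_by_kernel g S
    & forall g : {lrmorphism R -> pser_alg x}, is_retraction (pser_incl x) g ->
        exists2 S : subalgClosed R,
          sf_decomposition (pser x) S & split_by_kernel g S].
Proof.
have to_retr (S : subalgClosed R) : sf_decomposition (pser x) S ->
    exists2 g : {lrmorphism R -> pser_alg x},
      is_retraction (pser_incl x) g & split_by_kernel g S.
  move=> [a [phi [[[psi phiK psiK] phi_max] phiE]]].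
  exact: (decomposition_retraction phiK psiK phi_max phiE).
have to_sf (g : {lrmorphism R -> pser_alg x}) : is_retraction (pser_incl x) g ->
    exists2 S : subalgClosed R,
      sf_decomposition (pser x) S & split_by_kernel g S.
  move=> gr; exists (ker_subalg g).
    exact: retraction_decomposition.
  exact: retraction_split.
split=> //; split.
- exact: liftable_retraction.
- by move=> [g]; apply: retraction_liftable.
- by move=> [g /to_sf[S]]; exists S.
by move=> [S /to_retr[g]]; exists g.
Qed.
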